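(* Let the plant $(A,B,C)$ and the weights $W,V,Q,R$ be such that $(A,B)$ and $(A,W^{1/2})$ are controllable, and $(C,A)$ and $(Q^{1/2},A)$ are observable. Then all minimal stationary points $\mathsf K\in\mathcal{C}_n$ of the LQG problem $\min_{\mathsf K\in\mathcal{C}_n}J_n(\mathsf K)$ are globally optimal, and they are in the form $$A_{\mathsf K}=T(A-BK-LC)T^{-1},\qquad B_{\mathsf K}=-TL,\qquad C_{\mathsf K}=KT^{-1},$$ where $T\in\mathbb{R}^{n\times n}$ is an invertible matrix, and $$K=R^{-1}B^{\mathsf T}S,\qquad L=PC^{\mathsf T}V^{-1},$$ with $P$ and $S$ being the unique positive definite solutions to the Riccati equations $$AP+PA^{\mathsf T}-PC^{\mathsf T}V^{-1}CP+W=0,\qquad A^{\mathsf T}S+SA-SBR^{-1}B^{\mathsf T}S+Q=0.$$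
   Context: Fix integers $n,m,p\ge 1$, real matrices $A\in\mathbb{R}^{n\times n}$, $B\in\mathbb{R}^{n\times m}$, $C\in\mathbb{R}^{p\times n}$ (the plant $\dot x=Ax+Bu+w$, $y=Cx+v$, with $w,v$ white Gaussian noises of intensities $W,V$), and real symmetric matrices $W\succeq 0$ ($n\times n$), $V\succ 0$ ($p\times p$), $Q\succeq 0$ ($n\times n$), $R\succ 0$ ($m\times m$). A real square matrix is called stable if all its eigenvalues have negative real part. $\mathcal{V}_n$ is the linear space of matrices $\begin{bmatrix}0_{m\times p}&C_{\mathsf K}\\ B_{\mathsf K}&A_{\mathsf K}\end{bmatrix}\in\mathbb{R}^{(m+n)\times(p+n)}$ with $A_{\mathsf K}\in\mathbb{R}^{n\times n}$, $B_{\mathsf K}\in\mathbb{R}^{n\times p}$, $C_{\mathsf K}\in\mathbb{R}^{m\times n}$, and $\mathcal{C}_n\subseteq\mathcal{V}_n$ is the (open) subset of those $\mathsf K$ for which $A_{\mathrm{cl},\mathsf K}=\begin{bmatrix}A&BC_{\mathsf K}\\ B_{\mathsf K}C&A_{\mathsf K}\end{bmatrix}$ is stable. Such a $\mathsf K$ represents the dynamical controller $\dot\xi=A_{\mathsf K}\xi+B_{\mathsf K}y$, $u=C_{\mathsf K}\xi$. $J_n:\mathcal{C}_n\to\mathbb{R}$ is the resulting LQG cost $\lim_{T\to\infty}\frac1T\mathbb{E}\int_0^T(x^{\mathsf T}Qx+u^{\mathsf T}Ru)\,dt$, equivalently $$J_n(\mathsf K)=\operatorname{tr}\left(\begin{bmatrix}Q&0\\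 0&C_{\mathsf K}^{\mathsf T}RC_{\mathsf K}\end{bmatrix}X_{\mathsf K}\right),\qquad A_{\mathrm{cl},\mathsf K}X_{\mathsf K}+X_{\mathsf K}A_{\mathrm{cl},\mathsf K}^{\mathsf T}+\begin{bmatrix}W&0\\ 0&B_{\mathsf K}VB_{\mathsf K}^{\mathsf T}\end{bmatrix}=0,$$ where $X_{\mathsf K}$ is the unique solution. $J_n$ is real analytic on $\mathcal{C}_n$. A stationary point is a $\mathsf K\in\mathcal{C}_n$ at which the gradient of $J_n$ in $\mathcal{V}_n$ vanishes. $\mathsf K$ is minimal if $(A_{\mathsf K},B_{\mathsf K})$ is controllable and $(C_{\mathsf K},A_{\mathsf K})$ is observable. $\mathsf K$ is globally optimal if it minimizes $J_n$ over $\mathcal{C}_n$. *)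

(* Defs.v *)
From HB Require Import structures.
From mathcomp Require Import all_boot all_order all_algebra.
From mathcomp Require Import complex.
From mathcomp Require Import all_classical all_reals all_analysis.

Set Implicit Arguments.
Unset Strict Implicit.
Unset Printing Implicit Defensive.

Import Order.TTheory GRing.Theory Num.Theory numFieldNormedType.Exports.

Local Open Scope classical_set_scope.
Local Open Scope ring_scope.

Section matrix_notions.
Variable F : realType.

Definition posdef n (M : 'M[F]_n) : Prop :=
  M^T = M /\ forall x : 'cV[F]_n, x != 0 -> 0 < (x^T *m M *m x) 0 0.

Definition possemidef n (M : 'M[F]_n) : Prop :=
  M^T = M /\ forall x : 'cV[F]_n, 0 <= (x^T *m M *m x) 0 0.

(* The positive semidefinite square root M^{1/2}; it exists and is unique
   whenever M is positive semidefinite, and xget's default 0 is then unused. *)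
Definition sqrtmx n (M : 'M[F]_n) : 'M[F]_n :=
  xget 0 [set S : 'M[F]_n | possemidef S /\ S *m S = M].

Definition stable n (M : 'M[F]_n) : Prop :=
  forall z : F[i], eigenvalue (map_mx (real_complex F) M) z -> complex.Re z < 0.

(* Kalman rank conditions on [B, AB, ..., A^{n-1}B] and its dual. *)
Definition controllable n m (A : 'M[F]_n) (B : 'M[F]_(n, m)) : Prop :=
  \rank (\mxrow_(i < n) (A ^+ i *m B)) = n.

Definition observable p n (C : 'M[F]_(p, n)) (A : 'M[F]_n) : Prop :=
  \rank (\mxcol_(i < n) (C *m A ^+ i)) = n.

End matrix_notions.

Section LQG.
Variables (F : realType) (n m p : nat).

(* A dynamical controller is the block matrix [0, C_K; B_K, A_K]. *)
Definition ctrl_C (K : 'M[F]_(m + n, p + n)) : 'M[F]_(m, n) := ursubmx K.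
Definition ctrl_B (K : 'M[F]_(m + n, p + n)) : 'M[F]_(n, p) := dlsubmx K.
Definition ctrl_A (K : 'M[F]_(m + n, p + n)) : 'M[F]_n := drsubmx K.

Definition ctrl_space : set 'M[F]_(m + n, p + n) :=
  [set K | ulsubmx K = 0].

Definition minimal_ctrl (K : 'M[F]_(m + n, p + n)) : Prop :=
  controllable (ctrl_A K) (ctrl_B K) /\ observable (ctrl_C K) (ctrl_A K).

Variables (A : 'M[F]_n) (B : 'M[F]_(n, m)) (C : 'M[F]_(p, n)).

Definition closed_loop (K : 'M[F]_(m + n, p + n)) : 'M[F]_(n + n) :=
  block_mx A (B *m ctrl_C K) (ctrl_B K *m C) (ctrl_A K).

Definition stabilizing : set 'M[F]_(m + n, p + n) :=
  [set K | ctrl_space K /\ stable (closed_loop K)].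

Variables (W : 'M[F]_n) (V : 'M[F]_p) (Q : 'M[F]_n) (R : 'M[F]_m).

(* X_K, the unique solution of the Lyapunov equation when K is stabilizing. *)
Definition lqg_cov (K : 'M[F]_(m + n, p + n)) : 'M[F]_(n + n) :=
  xget 0 [set X : 'M[F]_(n + n) |
    closed_loop K *m X + X *m (closed_loop K)^T
      + block_mx W 0 0 (ctrl_B K *m V *m (ctrl_B K)^T) = 0].

(* Meaningful on stabilizing controllers only. *)
Definition lqg_cost (K : 'M[F]_(m + n, p + n)) : F :=
  \tr (block_mx Q 0 0 ((ctrl_C K)^T *m R *m ctrl_C K) *m lqg_cov K).

(* The gradient in ctrl_space for the Frobenius inner product: the matrix of
   partial derivatives, with zero upper left block.  The cost is analytic on
   the open subset stabilizing of ctrl_space, so these derivatives exist at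
   every stabilizing controller. *)
Definition lqg_grad (K : 'M[F]_(m + n, p + n)) : 'M[F]_(m + n, p + n) :=
  let D := \matrix_(i, j) 'D_(delta_mx i j) (lqg_cost : _ -> F^o) K in
  block_mx 0 (ursubmx D) (dlsubmx D) (drsubmx D).

Definition lqg_stationary (K : 'M[F]_(m + n, p + n)) : Prop :=
  stabilizing K /\ lqg_grad K = 0.

Definition lqg_optimal (K : 'M[F]_(m + n, p + n)) : Prop :=
  stabilizing K /\ forall K', stabilizing K' -> lqg_cost K <= lqg_cost K'.

Definition filter_riccati (P : 'M[F]_n) : Prop :=
  A *m P + P *m A^T - P *m C^T *m invmx V *m C *m P + W = 0.

Definition control_riccati (S : 'M[F]_n) : Prop :=
  A^T *m S + S *m A - S *m B *m invmx R *m B^T *m S + Q = 0.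

End LQG.

(* Main.v *)
Require Import Defs.
From HB Require Import structures.
From mathcomp Require Import all_boot all_order all_algebra.
From mathcomp Require Import complex.
From mathcomp Require Import all_classical all_reals all_analysis.
From mathcomp Require Import ring lra.
Import Order.TTheory GRing.Theory Num.Theory numFieldNormedType.Exports.
Local Open Scope ring_scope.

(* Let X and Y solve the closed-loop Lyapunov equation and its dual; minimality
   of the controller makes both positive definite.  With X12, X22, Y12, Y22
   their blocks, the vanishing of the A_K-gradient reads X12^T Y12 + X22 Y22 = 0,
   so X12 is invertible and T = - X22 X12^-1 relates the controller state xi to
   an estimate - T^-1 xi of the plant state.  The other two gradient equations
   give B_K and C_K in terms of the Schur complements P and S of X and Y, and
   the Lyapunov equations, projected on the estimation error x + T^-1 xi, give
   A_K and the two Riccati equations.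

   For optimality, completing the square with S writes the cost of any
   stabilizing controller as tr(S W) + tr(R [K C_K] X [K C_K]^T), while
   X - diag(P, 0) solves a Lyapunov equation with semidefinite source, hence is
   semidefinite.  So tr(S W) + tr(R K P K^T) bounds the cost from below, with
   equality at the controllers above.

   Lyapunov positivity is obtained by continuity along (1 - t) M - t I, from
   the injectivity of the Sylvester operator; existence for the Riccati
   equation by the Newton-Kleinman iteration, and uniqueness by the Sylvester
   equation satisfied by the difference of two solutions. *)

Set Implicit Arguments.
Unset Strict Implicit.
Unset Printing Implicit Defensive.

(** * Semidefinite matrices *)

Section Semidefinite.
Variable F : realType.

(** Row vectors, unlike the columns of [posdef], let left kernels and row spaces apply directly;
    [possemidefE] and [posdefE] translate. *)
Definition qf n (M : 'M[F]_n) (x y : 'rV[F]_n) : F := (x *m M *m y^T) 0 0.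

Lemma qfDl n (M : 'M[F]_n) a x y z : qf M (a *: x + y) z = a * qf M x z + qf M y z.
Proof. by rewrite /qf !mulmxDl -!scalemxAl !mxE. Qed.

Lemma qfZl n (M : 'M[F]_n) a x z : qf M (a *: x) z = a * qf M x z.
Proof. by rewrite /qf -!scalemxAl mxE. Qed.

Lemma qfDr n (M : 'M[F]_n) a x y z : qf M z (a *: x + y) = a * qf M z x + qf M z y.
Proof. by rewrite /qf linearP /= mulmxDr -scalemxAr !mxE. Qed.

Lemma qfC n (M : 'M[F]_n) x y : M^T = M -> qf M x y = qf M y x.
Proof.
move=> sM; rewrite /qf -[x *m M *m (y^T)]trmxK mxE trmx_mul trmxK trmx_mul sM.
by rewrite mulmxA.
Qed.

Lemma qf_mx n k l (M : 'M[F]_n) (U : 'M[F]_(k, n)) (U' : 'M[F]_(l, n)) i j :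
  (U *m M *m U'^T) i j = qf M (row i U) (row j U').
Proof.
by rewrite /qf -row_mul mxE [RHS]mxE; apply: eq_bigr => s _; rewrite !mxE.
Qed.

Lemma qf_delta n (M : 'M[F]_n) i j : qf M (delta_mx 0 i) (delta_mx 0 j) = M i j.
Proof. by rewrite /qf trmx_delta -rowE -colE !mxE. Qed.

Lemma qf_cong n k (M : 'M[F]_n) (U : 'M[F]_(k, n)) x y :
  qf (U *m M *m U^T) x y = qf M (x *m U) (y *m U).
Proof. by rewrite /qf trmx_mul !mulmxA. Qed.

Lemma qf_addmx n (M N : 'M[F]_n) x y : qf (M + N) x y = qf M x y + qf N x y.
Proof. by rewrite /qf mulmxDr mulmxDl mxE. Qed.

Lemma qf_scalemx n a (M : 'M[F]_n) x y : qf (a *: M) x y = a * qf M x y.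
Proof. by rewrite /qf -scalemxAr -scalemxAl mxE. Qed.

Lemma qf1 n (x : 'rV[F]_n) : qf 1%:M x x = \sum_j x 0 j ^+ 2.
Proof. by rewrite /qf mulmx1 mxE; apply: eq_bigr => j _; rewrite mxE. Qed.

Lemma possemidefE n (M : 'M[F]_n) :
  possemidef M <-> M^T = M /\ forall x, 0 <= qf M x x.
Proof.
split=> -[sM H]; split=> // x; first by have := H x^T; rewrite trmxK.
by have := H x^T; rewrite /qf trmxK.
Qed.

Lemma posdefE n (M : 'M[F]_n) :
  posdef M <-> M^T = M /\ forall x, x != 0 -> 0 < qf M x x.
Proof.
split=> -[sM H]; split=> // x x0.
  by have := H x^T; rewrite trmxK; apply; rewrite trmx_eq0.
by have := H x^T; rewrite /qf trmxK; apply; rewrite trmx_eq0.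
Qed.

Lemma posdef_sym n (M : 'M[F]_n) : posdef M -> M^T = M. Proof. by case. Qed.
Lemma possemidef_sym n (M : 'M[F]_n) : possemidef M -> M^T = M. Proof. by case. Qed.

Lemma possemidef_qf n (M : 'M[F]_n) x : possemidef M -> 0 <= qf M x x.
Proof. by move=> /possemidefE[]. Qed.

Lemma posdef_psd n (M : 'M[F]_n) : posdef M -> possemidef M.
Proof.
move=> /posdefE[sM H]; apply/possemidefE; split=> // x.
have [->|/H/ltW//] := eqVneq x 0.
by rewrite /qf !mul0mx mxE.
Qed.

Lemma possemidef_cong n k (M : 'M[F]_n) (U : 'M[F]_(k, n)) :
  possemidef M -> possemidef (U *m M *m U^T).
Proof.
move=> /possemidefE[sM H]; apply/possemidefE; split.
  by rewrite !trmx_mul trmxK sM mulmxA.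
by move=> x; rewrite qf_cong.
Qed.

Lemma possemidefD n (M N : 'M[F]_n) :
  possemidef M -> possemidef N -> possemidef (M + N).
Proof.
move=> /possemidefE[sM HM] /possemidefE[sN HN]; apply/possemidefE; split.
  by rewrite linearD /= sM sN.
by move=> x; rewrite qf_addmx addr_ge0.
Qed.

Lemma posdefD n (M N : 'M[F]_n) : posdef M -> possemidef N -> posdef (M + N).
Proof.
move=> /posdefE[sM HM] /possemidefE[sN HN]; apply/posdefE; split.
  by rewrite linearD /= sM sN.
by move=> x x0; rewrite qf_addmx ltr_wpDr ?HM.
Qed.

Lemma posdefZ n a (M : 'M[F]_n) : 0 < a -> posdef M -> posdef (a *: M).
Proof.
move=> a0 /posdefE[sM HM]; apply/posdefE; split; first by rewrite linearZ /= sM.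
by move=> x x0; rewrite qf_scalemx mulr_gt0 ?HM.
Qed.

Lemma posdef1 n : posdef (1%:M : 'M[F]_n).
Proof.
apply/posdefE; split; first by rewrite trmx1.
move=> x x0; rewrite qf1 lt_neqAle sumr_ge0 ?andbT => [|i _]; last exact: sqr_ge0.
apply: contra x0 => /eqP/esym H; apply/eqP/rowP => j; rewrite mxE.
by have /(_ j isT)/eqP := psumr_eq0P (fun i _ => sqr_ge0 (x 0 i)) H; rewrite sqrf_eq0 => /eqP.
Qed.

Lemma possemidef0 n : possemidef (0 : 'M[F]_n).
Proof.
apply/possemidefE; split; first by rewrite trmx0.
by move=> x; rewrite /qf mulmx0 mul0mx mxE.
Qed.

(* The discriminant of the nonnegative quadratic s |-> M[x - s y]. *)
Lemma possemidef_CS n (M : 'M[F]_n) x y :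
  possemidef M -> qf M x y ^+ 2 <= qf M x x * qf M y y.
Proof.
move=> /possemidefE[sM H].
have E s : 0 <= s ^+ 2 * qf M y y + 2 * s * qf M x y + qf M x x.
  have := H (s *: y + x); rewrite qfDl !qfDr (qfC y x sM); congr (0 <= _).
  by ring.
have [c0|c0] := eqVneq (qf M y y) 0.
  rewrite c0 mulr0; have [->|b0] := eqVneq (qf M x y) 0; first by rewrite expr0n.
  (* With [qf M y y = 0] the quadratic is affine in s, and this s gives it the value -1. *)
  have := E (- (qf M x x + 1) / (2 * qf M x y)); rewrite c0 mulr0 add0r.
  suff -> : 2 * (- (qf M x x + 1) / (2 * qf M x y)) * qf M x y + qf M x x = -1.
    by rewrite oppr_ge0 ler10.
  by field.
have c1 : 0 < qf M y y by rewrite lt_neqAle eq_sym c0 H.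
have := E (- qf M x y / qf M y y).
suff -> : (- qf M x y / qf M y y) ^+ 2 * qf M y y +
   2 * (- qf M x y / qf M y y) * qf M x y + qf M x x =
   (qf M x x * qf M y y - qf M x y ^+ 2) / qf M y y.
  by rewrite pmulr_lge0 ?invr_gt0 // subr_ge0.
by field.
Qed.

(** By Cauchy-Schwarz the square of an entry of [U M] is at most a diagonal entry of [U M U^T] times
    one of M. *)
Lemma possemidef_kill n k (M : 'M[F]_n) (U : 'M[F]_(k, n)) :
  possemidef M -> U *m M *m U^T = 0 -> U *m M = 0.
Proof.
move=> pM U0; apply/matrixP => i j.
rewrite -[U *m M]mulmx1 -[1%:M]trmx1 qf_mx mxE; apply/eqP.
rewrite -sqrf_eq0 eq_le sqr_ge0 andbT.
by rewrite (le_trans (possemidef_CS _ _ pM)) // -(qf_mx M U U) U0 mxE mul0r.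
Qed.

Lemma mxtrace_psd_ge0 n (M : 'M[F]_n) : possemidef M -> 0 <= \tr M.
Proof. by move=> pM; apply: sumr_ge0 => i _; rewrite -qf_delta possemidef_qf. Qed.

Lemma mxtrace_psd_eq0 n (M : 'M[F]_n) : possemidef M -> \tr M = 0 -> M = 0.
Proof.
move=> pM t0; have H k : M k k = 0.
  by apply: (psumr_eq0P _ t0) => // i _; rewrite -qf_delta possemidef_qf.
apply/matrixP => i j; rewrite mxE; apply/eqP.
rewrite -sqrf_eq0 eq_le sqr_ge0 andbT -[X in X ^+ 2]qf_delta.
rewrite (le_trans (possemidef_CS _ _ pM)) // !qf_delta.
by rewrite H mul0r.
Qed.

Lemma posdef_free n (M : 'M[F]_n) : posdef M -> M \in unitmx.
Proof.
move=> pM; rewrite -row_free_unit -kermx_eq0; apply/eqP/row_matrixP => i.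
rewrite row0; apply/eqP/negP => /negP ki.
move: (pM) => /posdefE[_ /(_ _ ki)]; rewrite /qf -row_mul mulmx_ker.
by rewrite row0 mul0mx mxE ltxx.
Qed.

Lemma possemidef_pd n (M : 'M[F]_n) : possemidef M -> kermx M = 0 -> posdef M.
Proof.
move=> pM k0; apply/posdefE; split; first exact: possemidef_sym.
move=> x x0; rewrite lt_neqAle possemidef_qf // andbT eq_sym.
apply: contra x0 => /eqP q0.
have : x *m M = 0.
  apply: possemidef_kill => //; apply/matrixP => i j.
  by rewrite !ord1 [LHS]q0 mxE.
by move/sub_kermxP; rewrite k0 submx0.
Qed.

Lemma posdef_cong n k (M : 'M[F]_n) (U : 'M[F]_(k, n)) :
  posdef M -> row_free U -> posdef (U *m M *m U^T).
Proof.
move=> pM fU; have [_ H] := (posdefE M).1 pM; apply/posdefE; split.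
  exact/possemidef_sym/possemidef_cong/posdef_psd.
by move=> x x0; rewrite qf_cong H // mulmx_free_eq0.
Qed.

Lemma posdef_inv n (M : 'M[F]_n) : posdef M -> posdef (invmx M).
Proof.
move=> pM; have uM := posdef_free pM.
have -> : invmx M = invmx M *m M *m (invmx M)^T.
  by rewrite mulVmx // mul1mx trmx_inv (posdef_sym pM).
by apply: posdef_cong; rewrite // row_free_unit unitmx_inv.
Qed.

(** Cauchy-Schwarz for the form M between x and [e_j M^-1]: the pairing is [x_j], and the form at
    [e_j M^-1] is the j-th diagonal entry of [M^-1]. *)
Lemma posdef_lower n (M : 'M[F]_n) (x : 'rV[F]_n) :
  posdef M -> \sum_j x 0 j ^+ 2 <= \tr (invmx M) * qf M x x.
Proof.
move=> pM; have uM := posdef_free pM; have sM := posdef_sym pM.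
rewrite /mxtrace mulr_suml; apply: ler_sum => j _.
pose e : 'rV[F]_n := delta_mx 0 j *m invmx M.
have -> : x 0 j = qf M e x.
  by rewrite qfC // /qf /e trmx_mul trmx_inv sM !mulmxA mulmxK // trmx_delta -colE mxE.
rewrite (le_trans (possemidef_CS _ _ (posdef_psd pM))) // le_eqVlt.
apply/orP; left; apply/eqP; congr (_ * _).
by rewrite -[RHS]qf_delta -[X in qf M X]/e /qf /e mulmxKV // trmx_mul trmx_inv sM mulmxA.
Qed.

Lemma qf_bound n (Z : 'M[F]_n) (x : 'rV[F]_n) :
  `|qf Z x x| <= (\sum_i \sum_j `|Z i j|) * \sum_j x 0 j ^+ 2.
Proof.
have xi i : `|x 0 i| ^+ 2 <= \sum_j x 0 j ^+ 2.
  rewrite (bigD1 i) //= real_normK ?num_real // lerDl sumr_ge0 // => j _.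
  exact: sqr_ge0.
rewrite /qf mxE (le_trans (ler_norm_sum _ _ _)) // exchange_big /= mulr_suml.
apply: ler_sum => j _; rewrite !mxE mulr_suml mulr_suml.
rewrite (le_trans (ler_norm_sum _ _ _)) //; apply: ler_sum => i _.
rewrite !normrM mulrAC mulrC ler_wpM2l //.
have := xi i; have := xi j; have := sqr_ge0 (`|x 0 i| - `|x 0 j|); nra.
Qed.

(** If the entries of [Z - M] are below c, its quadratic form is at most [n^2 c |x|^2], hence at
    most [n^2 c t] times that of M, where t is the trace of [M^-1]. The choice [c = 1 / (n^2 t + 1)]
    makes this factor less than 1. *)
Lemma posdef_open n (M : 'M[F]_n) : posdef M ->
  exists2 c : F, 0 < c & forall Z : 'M[F]_n, Z^T = Z ->
    (forall i j, `|Z i j - M i j| < c) -> posdef Z.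
Proof.
move=> pM; pose t := \tr (invmx M); have t0 : 0 <= t.
  exact/mxtrace_psd_ge0/posdef_psd/posdef_inv.
have d0 : 0 < n%:R * n%:R * t + 1 by rewrite ltr_wpDl // !mulr_ge0.
exists (n%:R * n%:R * t + 1)^-1; first by rewrite invr_gt0.
move=> Z sZ ZM; apply/posdefE; split=> // x x0.
have [_ Hp] := (posdefE M).1 pM; have := Hp x x0.
have l := posdef_lower x pM.
have := qf_bound (Z - M) x.
have -> : qf Z x x = qf M x x + qf (Z - M) x x by rewrite -qf_addmx addrC subrK.
set s := \sum_i _; set q := \sum_j _ in l *; set d := qf (Z - M) _ _.
have s1 : s * (n%:R * n%:R * t + 1) <= n%:R * n%:R.
  rewrite -ler_pdivlMr //.
  have -> : n%:R * n%:R / (n%:R * n%:R * t + 1) =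
     \sum_(i < n) \sum_(j < n) (n%:R * n%:R * t + 1)^-1.
    by rewrite !sumr_const card_ord -mulrnA -[RHS]mulr_natl natrM.
  by apply: ler_sum => i _; apply: ler_sum => j _; rewrite !mxE ltW.
have s0 : 0 <= s by apply: sumr_ge0 => i _; exact: sumr_ge0.
move=> dq m0; have := ler_norm (- d); rewrite normrN => dd.
have H1 : s * q <= s * t * qf M x x by rewrite -mulrA ler_wpM2l.
have H2 : s * t < 1.
  rewrite -(ltr_pM2r d0) mul1r mulrAC; apply: le_lt_trans (_ : n%:R * n%:R * t < _).
    by rewrite ler_wpM2r.
  by rewrite ltrDl.
nra.
Qed.

(** Induction on the number of nonzero diagonal entries of Z, by Cholesky elimination: a split-off
    term [z z^T] has trace [z^T M z] against M. *)
Lemma mxtrace_mul_psd n (M Z : 'M[F]_n) :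
  possemidef M -> possemidef Z -> 0 <= \tr (M *m Z).
Proof.
move=> pM; have [k] := ubnP #|[set i | Z i i != 0]|; elim: k Z => // k IH Z kZ pZ.
have sZ := possemidef_sym pZ.
have [/eqP t0|t0] := boolP (\tr Z == 0).
  by rewrite (mxtrace_psd_eq0 pZ t0) mulmx0 mxtrace0.
have [i Zi] : exists i, Z i i != 0.
  apply/existsP; apply: contraNT t0; rewrite negb_exists => /forallP H.
  by rewrite /mxtrace big1 // => i _; apply/eqP/negbNE/H.
have Zi0 : 0 < Z i i.
  by rewrite lt_neqAle eq_sym Zi -qf_delta possemidef_qf.
(* Subtracting the rank-one matrix z z^T / Z_ii annihilates the i-th row of Z. *)
pose z := col i Z; pose Z' := Z - (Z i i)^-1 *: (z *m z^T).
have Z'E j l : Z' j l = Z j l - (Z i i)^-1 * (Z j i * Z l i).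
  by rewrite !mxE big_ord1 !mxE.
have zq x : (x *m z) 0 0 = qf Z x (delta_mx 0 i).
  by rewrite /qf trmx_delta -mulmxA -colE.
have pZ' : possemidef Z'.
  apply/possemidefE; split.
    by rewrite linearB linearZ /= trmx_mul trmxK sZ.
  move=> x; rewrite qf_addmx -scaleNr qf_scalemx.
  have -> : qf (z *m z^T) x x = qf Z x (delta_mx 0 i) ^+ 2.
    rewrite /qf mulmxA -mulmxA -trmx_mul mxE big_ord1 [_^T _ _]mxE zq.
    by rewrite expr2.
  have := possemidef_CS x (delta_mx 0 i) pZ; rewrite qf_delta => cs.
  by rewrite mulNr subr_ge0 mulrC ler_pdivrMr.
have -> : Z = Z' + (Z i i)^-1 *: (z *m z^T) by rewrite subrK.
rewrite mulmxDr mxtraceD -scalemxAr mxtraceZ addr_ge0 //; last first.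
  rewrite mulr_ge0 ?invr_ge0 ?(ltW Zi0) // mulmxA mxtrace_mulC mulmxA.
  by rewrite trace_mx11; have := possemidef_qf z^T pM; rewrite /qf trmxK.
apply: IH => //; rewrite -ltnS; apply: leq_ltn_trans kZ.
(* A zero diagonal entry of Z forces its row to vanish, so it stays zero in [Z']; the i-th entry
   becomes zero. *)
apply/proper_card/properP; split.
  apply/fintype.subsetP => j; rewrite !inE; apply: contra => /eqP Zj0.
  suff Zji : Z j i = 0 by rewrite Z'E Zji Zj0 mul0r mulr0 subr0.
  apply/eqP; rewrite -sqrf_eq0 eq_le sqr_ge0 andbT -[X in X ^+ 2]qf_delta.
  by rewrite (le_trans (possemidef_CS _ _ pZ)) // !qf_delta Zj0 mul0r.
by exists i; rewrite !inE ?Zi // Z'E mulKf ?subrr ?eqxx.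
Qed.

End Semidefinite.

(** * Controllability and stability *)

(* Linear identities between matrices, with products treated as atoms. *)
Ltac mxlin :=
  repeat (let x := fresh in set x := (_ *m _); clearbody x);
  apply/matrixP => ? ?; rewrite !mxE; ring.

Ltac mxring :=
  rewrite ?(mulmxDl, mulmxDr, mulNmx, mulmxN, mulmxA, mul1mx, mulmx1,
           mul0mx, mulmx0, =^~ scalemxAl, =^~ scalemxAr);
  mxlin.

Section Controllability.
Variable F : realType.

(* PBH form of controllability; the row space of U plays the left eigenspace. *)
Definition ctrb n l (A : 'M[F]_n) (N : 'M[F]_(n, l)) : Prop :=
  forall k (U : 'M[F]_(k, n)), stablemx U A -> U *m N = 0 -> U = 0.

(** Invariance keeps each [U A^i] in the row space of U, so U annihilates the Kalman matrix, which
    has full row rank. *)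
Lemma controllable_ctrb n l (A : 'M[F]_n) (N : 'M[F]_(n, l)) :
  controllable A N -> ctrb A N.
Proof.
rewrite /controllable => r k U sU UN.
apply/eqP; rewrite -(mulmx_free_eq0 U (B := \mxrow_(i < n) (A ^+ i *m N))); last first.
  by rewrite /row_free r.
apply/eqP; rewrite mul_mxrow -[RHS]mxrow0; apply: eq_mxrow => i.
rewrite mulmxA; have /submxP[D ->] : (U *m A ^+ i <= U)%MS.
  elim: (i : nat) => [|j IH]; first by rewrite expr0 mulmx1.
  by rewrite exprSr mulmxA (submx_trans _ sU) // submxMr.
by rewrite -mulmxA UN mulmx0.
Qed.

Lemma observable_ctrb n l (C : 'M[F]_(l, n)) (A : 'M[F]_n) :
  observable C A -> ctrb A^T C^T.
Proof.
rewrite /observable -mxrank_tr tr_mxcol => r; apply: controllable_ctrb.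
rewrite /controllable -[RHS]r; congr (\rank _); apply: eq_mxrow => i.
by rewrite trmx_mul; congr (_ *m _); elim: (i : nat) => [|j IH];
  rewrite ?expr0 ?trmx1 // exprS exprSr [_ * _]/(_ *m _) trmx_mul -IH.
Qed.

Lemma ctrb_sub n l k (A A' : 'M[F]_n) (N : 'M[F]_(n, l)) (N' : 'M[F]_(n, k)) :
  ctrb A N ->
  (forall j (U : 'M[F]_(j, n)), U *m N' = 0 -> U *m N = 0 /\ U *m A = U *m A') ->
  ctrb A' N'.
Proof. by move=> c H k' U sU /H[UN UA]; apply: c => //; rewrite UA. Qed.

Lemma sqrtmx_sym n (M : 'M[F]_n) : (sqrtmx M)^T = sqrtmx M.
Proof. by rewrite /sqrtmx; case: xgetP => [S _ [[]]|_] //; rewrite trmx0. Qed.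

(** For a symmetric root S, [U M = 0] gives [(U S)(U S)^T = 0], hence [U S = 0]. *)
Lemma sqrtmx_ctrb n (A M : 'M[F]_n) : (0 < n)%N ->
  ctrb A (sqrtmx M) -> ctrb A M.
Proof.
move=> n0 H; rewrite /sqrtmx in H; case: xgetP H => [S _ [pS SM] H|_ H].
  apply: ctrb_sub H _ => j U UM; split=> //.
  have := possemidef_kill (U := U *m S) (posdef_psd (posdef1 F n)).
  rewrite !mulmx1 trmx_mul (possemidef_sym pS) mulmxA; apply.
  by rewrite -(mulmxA U) SM UM mul0mx.
(* If there is no root, [sqrtmx M] is the default 0, and [U = 1] contradicts [ctrb] because n is
   positive. *)
have := H n 1%:M; rewrite submx1 mul1mx => /(_ isT erefl) /matrixP.
move=> /(_ (Ordinal n0) (Ordinal n0)); rewrite !mxE eqxx => /eqP.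
by rewrite oner_eq0.
Qed.

End Controllability.

(** * Stability criteria and the Sylvester operator *)

Section Stability.
Variable F : realType.

(** Let x + i y be a left eigenvector for z. Adding the equation evaluated at x and at y gives [2 Re
    z (X[x] + X[y]) + N[x] + N[y] = 0]. If Re z were nonnegative, N would vanish on x and y, whose
    span is invariant under M, against [ctrb]. *)
Lemma ctrb_stable n (M N X : 'M[F]_n) :
  posdef X -> possemidef N -> M *m X + X *m M^T + N = 0 -> ctrb M N -> stable M.
Proof.
move=> pX pN e cMN z /eigenvalueP[v vz v0].
have ReD (u w : F[i]) : complex.Re (u + w) = complex.Re u + complex.Re w
  by case: u w => ? ? [].
have ImD (u w : F[i]) : complex.Im (u + w) = complex.Im u + complex.Im w
  by case: u w => ? ? [].
have ReM (u w : F[i]) : complex.Re (u * w) =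
  complex.Re u * complex.Re w - complex.Im u * complex.Im w by case: u w => ? ? [].
have ImM (u w : F[i]) : complex.Im (u * w) =
  complex.Re u * complex.Im w + complex.Im u * complex.Re w by case: u w => ? ? [].
pose x := map_mx (@complex.Re F) v; pose y := map_mx (@complex.Im F) v.
pose a := complex.Re z; pose b := complex.Im z.
have xM : x *m M = a *: x + (- b) *: y.
  apply/rowP => j; have := congr1 (fun w : 'rV_n => complex.Re (w 0 j)) vz.
  rewrite /= !mxE (big_morph _ ReD (erefl : complex.Re 0 = 0)) ReM mulNr => <-.
  by apply: eq_bigr => k _; rewrite !mxE ReM /= mulr0 subr0.
have yM : y *m M = b *: x + a *: y.
  apply/rowP => j; have := congr1 (fun w : 'rV_n => complex.Im (w 0 j)) vz.
  rewrite /= !mxE (big_morph _ ImD (erefl : complex.Im 0 = 0)) ImM addrC => <-.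
  by apply: eq_bigr => k _; rewrite !mxE ImM /= mulr0 add0r.
have qe w : 2 * qf X (w *m M) w + qf N w w = 0.
  transitivity (qf (M *m X + X *m M^T + N) w w); last first.
    by rewrite e /qf mulmx0 mul0mx mxE.
  rewrite !qf_addmx; congr (_ + _).
  have -> : qf (M *m X) w w = qf X (w *m M) w by rewrite /qf !mulmxA.
  have -> : qf (X *m M^T) w w = qf X w (w *m M) by rewrite /qf trmx_mul !mulmxA.
  by rewrite (qfC w) ?posdef_sym // mulr2n mulrDl mul1r.
have [_ pX'] := (posdefE X).1 pX.
have xy : 0 < qf X x x + qf X y y.
  have [x0|x0] := eqVneq x 0; last first.
    by rewrite ltr_pwDl ?pX' ?possemidef_qf //; exact: posdef_psd.
  rewrite ltr_wpDl ?possemidef_qf ?pX' //; first exact: posdef_psd.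
  apply: contra v0 => /eqP y0; apply/eqP/rowP => j.
  have := congr1 (fun w : 'rV_n => w 0 j) x0; have := congr1 (fun w : 'rV_n => w 0 j) y0.
  by rewrite !mxE; case: (v 0 j) => /= ? ? -> ->.
have e2 : 2 * a * (qf X x x + qf X y y) + (qf N x x + qf N y y) = 0.
  have := congr2 +%R (qe x) (qe y).
  rewrite xM yM !qfDl !qfZl (qfC y x) ?posdef_sym // addr0 => <-.
  by ring.
have nx := possemidef_qf x pN; have ny := possemidef_qf y pN.
rewrite -/a ltNge; apply/negP => a0.
have [x0 y0] : qf N x x = 0 /\ qf N y y = 0 by split; nra.
have kill w : qf N w w = 0 -> w *m N = 0.
  move=> w0; apply: possemidef_kill => //; apply/matrixP => i j.
  by rewrite !ord1 [LHS]w0 mxE.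
have := cMN _ (col_mx x y); rewrite !mul_col_mx !kill // col_mx0.
have sx : (x <= col_mx x y)%MS by rewrite -addsmxE addsmxSl.
have sy : (y <= col_mx x y)%MS by rewrite -addsmxE addsmxSr.
rewrite col_mx_sub xM yM !addmx_sub ?scalemx_sub //= => /(_ isT erefl)/eqP.
rewrite col_mx_eq0 => /andP[/eqP xx /eqP yy]; move: xy.
by rewrite xx yy /qf !mul0mx mxE addr0 ltxx.
Qed.

Lemma stable_tr n (M : 'M[F]_n) : stable M -> stable M^T.
Proof.
have char_tr (K : comNzRingType) (B : 'M[K]_n) : char_poly B^T = char_poly B.
  rewrite /char_poly /char_poly_mx -[RHS]det_tr linearB /= tr_scalar_mx.
  by rewrite map_trmx.
move=> sM z; rewrite eigenvalue_root_char -map_trmx char_tr.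
by rewrite -eigenvalue_root_char => /sM.
Qed.

(** From [M1 X = X (- M2)] follows [p(M1) X = X p(- M2)] for every polynomial p. For the
    characteristic polynomial of M1 the left side is 0 by Cayley-Hamilton, while each factor
    [- M2 - z] is invertible, since z has negative real part and the eigenvalues of [- M2] have
    positive real part. *)
Lemma sylvester_inj n k (M1 : 'M[F]_n) (M2 : 'M[F]_k) X :
  stable M1 -> stable M2 -> M1 *m X + X *m M2 = 0 -> X = 0.
Proof.
case: n M1 X => [|n] M1 X; first by rewrite [X]flatmx0.
case: k M2 X => [|k] M2 X; first by rewrite [X]thinmx0.
move=> s1 s2 /eqP; rewrite addr_eq0 => /eqP e.
apply: (@map_mx_inj _ _ (real_complex F)); rewrite map_mx0.
set c := map_mx (real_complex F) in s1 s2 *.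
pose N1 := map_mx (real_complex F) M1; pose N2 := - map_mx (real_complex F) M2.
pose Y := map_mx (real_complex F) X.
have eY : N1 *m Y = Y *m N2 by rewrite /N1 /N2 -map_mxM e map_mxN map_mxM mulmxN.
have eP p : horner_mx N1 p *m Y = Y *m horner_mx N2 p.
  elim/poly_ind: p => [|p a IH]; first by rewrite !rmorph0 mul0mx mulmx0.
  rewrite !rmorphD !rmorphM /= !horner_mx_X !horner_mx_C.
  rewrite mulmxDl mulmxDr mul_scalar_mx mul_mx_scalar; congr (_ + _).
  by rewrite -mulmxA eY mulmxA IH mulmxA.
have := eP (char_poly N1); rewrite Cayley_Hamilton mul0mx => /esym.
have [r Er] := closed_field_poly_normal (char_poly N1).
have rr z : z \in r -> complex.Re z < 0.
  move=> zr; apply: s1; rewrite eigenvalue_root_char Er rootZ ?root_prod_XsubC //.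
  by rewrite lead_coef_eq0 -size_poly_eq0 size_char_poly.
rewrite Er (eqP (char_poly_monic _)) scale1r.
elim: r rr {Er} => [|z r IH] rr; first by rewrite big_nil rmorph1 mulmx1.
rewrite big_cons mulrC rmorphM /= rmorphB /= horner_mx_X horner_mx_C.
rewrite -[_ * _]/(_ *m _) mulmxA => /eqP; rewrite mulmx_free_eq0; last first.
  rewrite -kermx_eq0; apply: contraT => ev.
  have /eigenvalueP[v vN v0] : eigenvalue N2 z by [].
  have /s2 : eigenvalue (map_mx (real_complex F) M2) (- z).
    apply/eigenvalueP; exists v => //; apply: oppr_inj.
    by rewrite -mulmxN vN scaleNr opprK.
  have := rr z (mem_head _ _); case: (z) => a b /= a0.
  by rewrite oppr_lt0 ltNge (ltW a0).
by move=> /eqP; apply: IH => w wr; apply: rr; rewrite inE wr orbT.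
Qed.

(* The endpoint t = 1 of this homotopy is -I, whatever M. *)
Lemma stable_homotopy n (M : 'M[F]_n) t :
  0 <= t <= 1 -> stable M -> stable ((1 - t) *: M - t%:M).
Proof.
move=> /andP[t0 t1] sM z /eigenvalueP[v vz v0].
have {}vz : (1 - t)%:C%C *: (v *m map_mx (real_complex F) M) = (z + t%:C%C) *: v.
  rewrite scalerDl -vz map_mxB map_mxZ map_scalar_mx mulmxBr -scalemxAr.
  by rewrite mul_mx_scalar subrK.
have [t1'|t1'] := eqVneq t 1.
  move: vz; rewrite t1' subrr scale0r => /esym/eqP.
  rewrite scaler_eq0 (negbTE v0) orbF addr_eq0 => /eqP ->.
  by rewrite /= oppr_lt0 ltr01.
have s0 : 0 < 1 - t by rewrite subr_gt0 lt_neqAle t1' t1.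
have /sM : eigenvalue (map_mx (real_complex F) M) (((1 - t)^-1)%:C%C * (z + t%:C%C)).
  apply/eigenvalueP; exists v => //; rewrite -scalerA -vz scalerA -rmorphM /=.
  by rewrite mulVf ?gt_eqF // scale1r.
case: (z) => a b /=; rewrite mul0r subr0 pmulr_rlt0 ?invr_gt0 // => h.
by apply: le_lt_trans h; rewrite lerDl.
Qed.
End Stability.

(** * Limits of matrices and Lyapunov equations *)

Section MatrixLimits.
Variables (F : realType) (T : choiceType) (Fl : set_system T).
Context {Fl_proper : ProperFilter Fl}.
Local Open Scope classical_set_scope.

Definition mcvg m n (f : T -> 'M[F]_(m, n)) (M : 'M[F]_(m, n)) : Prop :=
  forall i j, f t i j @[t --> Fl] --> M i j.

Lemma cvg_sumr I (r : seq I) (P : pred I) (f : I -> T -> F) (l : I -> F) :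
  (forall i, P i -> f i t @[t --> Fl] --> l i) ->
  \sum_(i <- r | P i) f i t @[t --> Fl] --> \sum_(i <- r | P i) l i.
Proof. by move=> h; apply: cvg_big => //; exact: add_continuous. Qed.

Lemma cvg_prodr I (r : seq I) (P : pred I) (f : I -> T -> F) (l : I -> F) :
  (forall i, P i -> f i t @[t --> Fl] --> l i) ->
  \prod_(i <- r | P i) f i t @[t --> Fl] --> \prod_(i <- r | P i) l i.
Proof. by move=> h; apply: cvg_big => //; exact: mul_continuous. Qed.

Lemma mcvg_cst m n (M : 'M[F]_(m, n)) : mcvg (fun=> M) M.
Proof. by move=> i j; exact: cvg_cst. Qed.

Lemma mcvgD m n (f g : T -> 'M[F]_(m, n)) M N :
  mcvg f M -> mcvg g N -> mcvg (fun t => f t + g t) (M + N).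
Proof.
move=> fM gN i j; rewrite mxE.
by under eq_fun do rewrite mxE; apply: cvgD; [exact: fM|exact: gN].
Qed.

Lemma mcvgN m n (f : T -> 'M[F]_(m, n)) M : mcvg f M -> mcvg (fun t => - f t) (- M).
Proof.
move=> fM i j; rewrite mxE.
by under eq_fun do rewrite mxE; apply: cvgN; exact: fM.
Qed.

Lemma mcvgZ m n (a : T -> F) (l : F) (f : T -> 'M[F]_(m, n)) M :
  a t @[t --> Fl] --> l -> mcvg f M -> mcvg (fun t => a t *: f t) (l *: M).
Proof.
move=> al fM i j; rewrite mxE.
by under eq_fun do rewrite mxE; apply: cvgM => //; exact: fM.
Qed.

Lemma mcvgM m n k (f : T -> 'M[F]_(m, n)) (g : T -> 'M[F]_(n, k)) M N :
  mcvg f M -> mcvg g N -> mcvg (fun t => f t *m g t) (M *m N).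
Proof.
move=> fM gN i j; rewrite mxE; under eq_fun do rewrite mxE.
by apply: cvg_sumr => l _; apply: cvgM; [exact: fM|exact: gN].
Qed.

Lemma mcvg_tr m n (f : T -> 'M[F]_(m, n)) M :
  mcvg f M -> mcvg (fun t => (f t)^T) M^T.
Proof. by move=> fM i j; rewrite mxE; under eq_fun do rewrite mxE; exact: fM. Qed.

Lemma mcvg_mxtrace n (f : T -> 'M[F]_n) M :
  mcvg f M -> \tr (f t) @[t --> Fl] --> \tr M.
Proof. by move=> fM; apply: cvg_sumr => i _; exact: fM. Qed.

Lemma mcvg_det n (f : T -> 'M[F]_n) M :
  mcvg f M -> \det (f t) @[t --> Fl] --> \det M.
Proof.
move=> fM; apply: cvg_sumr => s _; apply: cvgM; first exact: cvg_cst.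
by apply: cvg_prodr => i _; exact: fM.
Qed.

Lemma mcvg_unit n (f : T -> 'M[F]_n) M :
  M \in unitmx -> mcvg f M -> \forall t \near Fl, f t \in unitmx.
Proof.
rewrite unitmxE unitfE => uM /mcvg_det fM.
have : \forall t \near Fl, \det (f t) != 0.
  by move/cvgr_neq0 : fM => /(_ uM).
by apply: filterS => t; rewrite unitmxE unitfE.
Qed.

Lemma mcvg_inv n (f : T -> 'M[F]_n) M :
  M \in unitmx -> mcvg f M -> mcvg (fun t => invmx (f t)) (invmx M).
Proof.
move=> uM fM i j.
(* Cramer's formula holds only where [f t] is invertible, which is the case near the limit. *)
have e t : f t \in unitmx ->
   (\det (f t))^-1 * cofactor (f t) j i = invmx (f t) i j.
  by rewrite /invmx => ->; rewrite !mxE.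
have -> : invmx M i j = (\det M)^-1 * cofactor M j i.
  by rewrite /invmx uM !mxE.
suff H : (\det (f t))^-1 * cofactor (f t) j i @[t --> Fl] --> (\det M)^-1 * cofactor M j i.
  apply: cvg_trans H; apply: near_eq_cvg.
  by apply: filterS (mcvg_unit uM fM) => t /e.
apply: cvgM.
  apply: cvgV; first by move: uM; rewrite unitmxE unitfE.
  exact: mcvg_det.
apply: cvgM; first exact: cvg_cst.
apply: mcvg_det => k l; rewrite !mxE.
by under eq_fun do rewrite !mxE; exact: fM.
Qed.

Lemma mcvg_unique m n (f : T -> 'M[F]_(m, n)) M N :
  mcvg f M -> mcvg f N -> M = N.
Proof.
by move=> fM fN; apply/matrixP => i j; apply: cvg_unique (fM i j) (fN i j).
Qed.

Lemma mcvg_near m n (f g : T -> 'M[F]_(m, n)) M :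
  (\forall t \near Fl, f t = g t) -> mcvg f M -> mcvg g M.
Proof.
move=> e fM i j; apply: cvg_trans (fM i j).
by apply: near_eq_cvg; apply: filterS e => t ->.
Qed.

Lemma mcvg_qf n (f : T -> 'M[F]_n) M x y :
  mcvg f M -> qf (f t) x y @[t --> Fl] --> qf M x y.
Proof.
move=> fM; apply: (@mcvgM _ _ _ (fun t => x *m f t) (fun=> y^T)); last exact: mcvg_cst.
by apply: mcvgM => //; exact: mcvg_cst.
Qed.

Lemma mcvg_psd n (f : T -> 'M[F]_n) M :
  (\forall t \near Fl, possemidef (f t)) -> mcvg f M -> possemidef M.
Proof.
move=> pf fM; apply/possemidefE; split.
  apply: (mcvg_unique (mcvg_tr fM)); apply: mcvg_near fM.
  by apply: filterS pf => t /possemidef_sym.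
move=> x; have q := mcvg_qf (x := x) (y := x) fM.
rewrite -(cvg_lim (@Rhausdorff F) q); apply: limr_ge; first exact: cvgP q.
by apply: filterS pf => t; exact: possemidef_qf.
Qed.

End MatrixLimits.

(** * Lyapunov equations as linear systems *)

Section Lyapunov.
Variable F : realType.

(** The operator [X |-> M X + X M^T] acting on vectorized matrices, so that continuity of its
    inverse comes from [mcvg_inv]. *)
Definition lyapmx n (M : 'M[F]_n) : 'M[F]_(n * n) :=
  lin_mulmx M + lin_mulmxr M^T.

Lemma mul_lyapmx n (M X : 'M[F]_n) :
  mxvec X *m lyapmx M = mxvec (M *m X + X *m M^T).
Proof. by rewrite mulmxDr !mul_vec_lin linearD. Qed.

Definition lyapsol n (M N : 'M[F]_n) : 'M[F]_n :=
  vec_mx (mxvec (- N) *m invmx (lyapmx M)).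

Lemma lyapsolP n (M N : 'M[F]_n) : lyapmx M \in unitmx ->
  M *m lyapsol M N + lyapsol M N *m M^T + N = 0.
Proof.
move=> u; apply/eqP; rewrite addr_eq0; apply/eqP/(can_inj mxvecK).
by rewrite -mul_lyapmx vec_mxK mulmxKV.
Qed.

Lemma lyapsol_unique n (M N X : 'M[F]_n) : lyapmx M \in unitmx ->
  M *m X + X *m M^T + N = 0 -> X = lyapsol M N.
Proof.
move=> u /eqP; rewrite addr_eq0 => /eqP e; apply/(can_inj mxvecK).
by rewrite vec_mxK -e -mul_lyapmx mulmxK.
Qed.

Lemma stable_lyapmx n (M : 'M[F]_n) : stable M -> lyapmx M \in unitmx.
Proof.
move=> sM; rewrite -row_free_unit -kermx_eq0; apply/eqP/row_matrixP => i.
rewrite row0; apply/(can_inj vec_mxK); rewrite linear0.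
apply: (sylvester_inj sM (stable_tr sM)); apply/(can_inj mxvecK).
by rewrite -mul_lyapmx vec_mxK -row_mul mulmx_ker row0 linear0.
Qed.

Lemma lyapsol_sym n (M N : 'M[F]_n) : lyapmx M \in unitmx -> N^T = N ->
  (lyapsol M N)^T = lyapsol M N.
Proof.
move=> u sN; apply: lyapsol_unique => //.
have := congr1 trmx (lyapsolP N u).
by rewrite !linearD /= !trmx_mul !trmxK sN trmx0 [X in X + N]addrC.
Qed.

Section LyapunovLimits.
Local Open Scope classical_set_scope.

Lemma mcvg_lyapmx (T : choiceType) (Fl : set_system T) {FF : ProperFilter Fl}
    n (f : T -> 'M[F]_n) M : mcvg Fl f M -> mcvg Fl (fun t => lyapmx (f t)) (lyapmx M).
Proof.
move=> fM; apply: mcvgD => i j; rewrite !mxE /=; under eq_fun do rewrite !mxE /=.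
  case: (mxvec_indexP j) => k l; rewrite mxvecE; under eq_fun do rewrite mxvecE.
  by apply: mcvgM => //; exact: mcvg_cst.
case: (mxvec_indexP j) => k l; rewrite mxvecE; under eq_fun do rewrite mxvecE.
by apply: mcvgM; [exact: mcvg_cst|exact: mcvg_tr].
Qed.

Lemma mcvg_lyapsol (T : choiceType) (Fl : set_system T) {FF : ProperFilter Fl}
    n (f g : T -> 'M[F]_n) M N : lyapmx M \in unitmx ->
  mcvg Fl f M -> mcvg Fl g N ->
  mcvg Fl (fun t => lyapsol (f t) (g t)) (lyapsol M N).
Proof.
move=> u fM gN i j; rewrite mxE; under eq_fun do rewrite mxE.
apply: mcvgM; last by apply: mcvg_inv => //; exact: mcvg_lyapmx.
move=> {}i {}j; rewrite ord1; case: (mxvec_indexP j) => k l; rewrite mxvecE.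
by under eq_fun do rewrite mxvecE; exact: mcvgN.
Qed.

End LyapunovLimits.

End Lyapunov.

(** * Positivity of Lyapunov solutions *)

Section LyapunovPositivity.
Variable F : realType.

(** The left kernel U of X satisfies [U N U^T = 0], so [U N = 0], and then [U M X = 0]: it is
    invariant under M and killed by N. *)
Lemma psd_ctrb_pd n (M N X : 'M[F]_n) :
  possemidef X -> possemidef N -> M *m X + X *m M^T + N = 0 -> ctrb M N ->
  posdef X.
Proof.
move=> pX pN e cMN; apply: possemidef_pd => //.
set U := kermx X; have UX : U *m X = 0 by exact: mulmx_ker.
have XU : X *m U^T = 0 by rewrite -[X](possemidef_sym pX) -trmx_mul UX trmx0.
have UN : U *m N = 0.
  apply: possemidef_kill => //; have := congr1 (fun Z => U *m Z *m U^T) e.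
  rewrite /= mulmx0 mul0mx !mulmxDr !mulmxDl => <-.
  by rewrite !mulmxA UX -!mulmxA XU !mul0mx !mulmx0 !add0r.
apply: (cMN _ U) => //; apply/sub_kermxP.
have := congr1 (mulmx U) e.
by rewrite mulmx0 !mulmxDr !mulmxA UX UN mul0mx !addr0.
Qed.

Lemma posdef_ctrb n (M N : 'M[F]_n) : posdef N -> ctrb M N.
Proof.
move=> /posdef_free uN k U _ /eqP; rewrite mulmx_free_eq0 ?row_free_unit //.
by move/eqP.
Qed.

(** Continuity method: let s be the supremum of the times in [0, 1] at which the solution [X t] is
    not positive definite. *)
Lemma lyapsol_posdef n (M N : 'M[F]_n) :
  stable M -> posdef N -> posdef (lyapsol M N).
Proof.
move=> sM pN; apply: contrapT => npd.
pose Mt t := (1 - t) *: M - t *: 1%:M; pose X t := lyapsol (Mt t) N.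
pose E := [set t | 0 <= t <= 1 /\ ~ posdef (X t)]%classic.
have Mt0 : Mt 0 = M by rewrite /Mt subr0 !scale1r scale0r subr0.
have E0 : E 0 by split; [rewrite lexx ler01|rewrite /X Mt0].
have hE : has_sup E.
  by split; [exists 0|exists 1 => t [/andP[]]].
set s := sup E.
have s01 : 0 <= s <= 1.
  apply/andP; split; first by apply: sup_upper_bound.
  by apply: ge_sup; [exists 0|move=> t [/andP[]]].
have uMt t : 0 <= t <= 1 -> lyapmx (Mt t) \in unitmx.
  by move=> t01; rewrite /Mt scalemx1; exact/stable_lyapmx/stable_homotopy.
have Xcvg (Fl : set_system F) (FF : ProperFilter Fl) :
    (t @[t --> Fl] --> s)%classic -> mcvg Fl X (X s).
  move=> ts; apply: mcvg_lyapsol; [exact: uMt| |exact: mcvg_cst].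
  apply: mcvgD; last apply: mcvgN.
    by apply: mcvgZ; [apply: cvgB => //; exact: cvg_cst|exact: mcvg_cst].
  by apply: mcvgZ => //; exact: mcvg_cst.
have Xsym t : 0 <= t <= 1 -> (X t)^T = X t.
  by move=> t01; apply: lyapsol_sym; [exact: uMt|exact: posdef_sym].
(* If [X s] is positive definite, so is [X t] for all t near s, which excludes the elements of E
   close to s. *)
have [ps|nps] := pselect (posdef (X s)).
  have [c c0 Hc] := posdef_open ps.
  have : \forall t \near s, forall i j, `|X t i j - X s i j| < c.
    apply: (@filter_forall _ _ (fun i t => forall j, `|X t i j - X s i j| < c)
      _ (nbhs_filter s)) => i.
    apply: (@filter_forall _ _ (fun j t => `|X t i j - X s i j| < c)
      _ (nbhs_filter s)) => j.
    have := @cvgr_dist_lt _ _ _ _ (nbhs_filter s) _ _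
      (Xcvg _ (nbhs_pfilter s) (@cvg_id _ (nbhs s)) i j) _ c0.
    by apply: (@filterS _ _ (nbhs_filter s)) => t Ht; rewrite distrC; exact: Ht.
  move=> /nbhs_ballP[e e0 He].
  have [t Et st] := sup_adherent e0 hE; have [t01 npt] := Et; apply: npt.
  apply: Hc; first exact: Xsym.
  apply: He; rewrite /ball /= ger0_norm; first by rewrite ltrBlDr addrC -ltrBlDr.
  by rewrite subr_ge0 sup_upper_bound.
(* At t = 1 the equation reads [- 2 X + N = 0]. Hence s < 1, [X t] is positive definite on (s, 1),
   and [X s] is a semidefinite limit, definite by [psd_ctrb_pd]. *)
have X1 : posdef (X 1).
  suff -> : X 1 = 2^-1 *: N by apply: posdefZ.
  apply/esym/lyapsol_unique; first by apply: uMt; rewrite ler01 lexx.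
  rewrite /Mt subrr scale0r scale1r add0r linearN /= trmx1 mulNmx mulmxN mul1mx mulmx1.
  rewrite -[X in _ + X]scale1r -!scaleNr -!scalerDl; apply/eqP; rewrite scaler_eq0.
  by apply/orP; left; apply/eqP; field.
have s1 : s < 1.
  move/andP: s01 => [_]; rewrite le_eqVlt => /orP[/eqP s1|//].
  by case: nps; rewrite s1.
have psd : possemidef (X s).
  apply: (@mcvg_psd _ _ (at_right s) _ _ X); last first.
    by apply: Xcvg; apply: cvg_at_right_filter; exact: cvg_id.
  near=> t; apply: posdef_psd; apply: contrapT => npt.
  have st : s < t by near: t; exact: nbhs_right_gt.
  have t1 : t < 1 by near: t; exact: nbhs_right_lt.
  have Et : E t.
    split; last exact: npt.
    apply/andP; split; last exact: ltW.
    by apply: le_trans (ltW st); case/andP: s01.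
  by have := sup_upper_bound hE Et; rewrite leNgt st.
apply: nps; apply: (psd_ctrb_pd psd (posdef_psd pN) (lyapsolP N (uMt s s01))).
exact: posdef_ctrb.
Unshelve. all: by end_near. Qed.

(** Perturb the source by a small multiple of the identity to make it positive definite. *)
Lemma stable_lyap_psd n (M N X : 'M[F]_n) : stable M -> possemidef N ->
  M *m X + X *m M^T + N = 0 -> possemidef X.
Proof.
move=> sM pN e; have u := stable_lyapmx sM.
have sX : X^T = X.
  by rewrite (lyapsol_unique u e) lyapsol_sym // possemidef_sym.
have [Y pY eY] : exists2 Y, posdef Y & M *m Y + Y *m M^T + 1%:M = 0.
  exists (lyapsol M 1%:M); last exact: lyapsolP.
  by apply: lyapsol_posdef => //; exact: posdef1.
apply/possemidefE; split=> // x.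
apply/ler_addgt0Pr => r r0.
have [->|x0] := eqVneq x 0; first by rewrite /qf !mul0mx mxE add0r ltW.
have [_ /(_ x x0) y0] := (posdefE Y).1 pY.
(* This d makes the perturbation contribute exactly r at x. *)
pose d := r / qf Y x x; have d0 : 0 < d by rewrite divr_gt0.
have eqd : X + d *: Y = lyapsol M (N + d *: 1%:M).
  apply: lyapsol_unique => //.
  transitivity ((M *m X + X *m M^T + N) + d *: (M *m Y + Y *m M^T + 1%:M)).
    by rewrite mulmxDr mulmxDl -scalemxAl -scalemxAr; mxlin.
  by rewrite e eY scaler0 addr0.
have : posdef (X + d *: Y).
  rewrite eqd; apply: lyapsol_posdef => //; rewrite addrC.
  by apply: posdefD => //; apply: posdefZ => //; exact: posdef1.
move=> /posdefE[_ /(_ x x0)]; rewrite qf_addmx qf_scalemx /d divfK ?gt_eqF //.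
exact: ltW.
Qed.

Lemma stable_lyap_pd n (M N X : 'M[F]_n) : stable M -> possemidef N ->
  M *m X + X *m M^T + N = 0 -> ctrb M N -> posdef X.
Proof. by move=> sM pN e; apply: psd_ctrb_pd => //; exact: stable_lyap_psd e. Qed.

End LyapunovPositivity.

(** * The Riccati equation *)

Section Riccati.
Variables (F : realType) (n p : nat).
Variables (A : 'M[F]_n) (C : 'M[F]_(p, n)).

(** The traces of [U M U^T] and [U N U^T] are nonnegative and sum to 0. *)
Lemma possemidefD_kill k m (M N : 'M[F]_m) (U : 'M[F]_(k, m)) :
  possemidef M -> possemidef N -> U *m (M + N) = 0 -> U *m M = 0 /\ U *m N = 0.
Proof.
move=> pM pN e; have e' : U *m M *m U^T + U *m N *m U^T = 0.
  by rewrite -mulmxDl -mulmxDr e mul0mx.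
have tM := mxtrace_psd_ge0 (possemidef_cong U pM).
have tN := mxtrace_psd_ge0 (possemidef_cong U pN).
have := congr1 mxtrace e'; rewrite mxtraceD mxtrace0 => /eqP.
rewrite paddr_eq0 // => /andP[/eqP t1 /eqP t2].
by split; apply: possemidef_kill => //; apply: mxtrace_psd_eq0 => //;
  exact: possemidef_cong.
Qed.

Lemma posdef_cong_kill k m l (V : 'M[F]_l) (L : 'M[F]_(m, l)) (U : 'M[F]_(k, m)) :
  posdef V -> U *m (L *m V *m L^T) = 0 -> U *m L = 0.
Proof.
move=> pV e; apply/eqP; rewrite -(mulmx_free_eq0 _ (B := V)); last first.
  by rewrite row_free_unit posdef_free.
apply/eqP/possemidef_kill; first exact: posdef_psd.
by rewrite trmx_mul !mulmxA -(mulmxA U) -(mulmxA U) e mul0mx.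
Qed.

(* Bass' construction: Z solves the Lyapunov equation of the anti-stable shift of A. *)
Lemma detectable : ctrb A^T C^T -> exists L : 'M[F]_(n, p), stable (A - L *m C).
Proof.
move=> cAC; have [c c0 Hc] := posdef_open (posdef1 F n).
(* With [e = c / s] the matrix [1 + e (A + A^T)] is within c of the identity, so [e^-1 + A + A^T] is
   positive definite. *)
pose s := 1 + \sum_i \sum_j `|(A + A^T) i j|.
have s0 : 0 < s by rewrite ltr_pwDl // sumr_ge0 // => i _; exact: sumr_ge0.
pose e := c / s; have e0 : 0 < e by rewrite divr_gt0.
have pN : posdef (e^-1 *: 1%:M + (A + A^T)).
  have -> : e^-1 *: 1%:M + (A + A^T) = e^-1 *: (1%:M + e *: (A + A^T)).
    by rewrite scalerDr scalerA mulVf ?gt_eqF // scale1r.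
  apply: posdefZ; first by rewrite invr_gt0.
  apply: Hc; first by rewrite linearD linearZ /= linearD /= trmx1 trmxK (addrC A).
  move=> i j; have -> : (1%:M + e *: (A + A^T)) i j - (1%:M : 'M[F]_n) i j = e * (A + A^T) i j.
    by rewrite !mxE; ring.
  rewrite normrM gtr0_norm // /e mulrAC ltr_pdivrMr // ltr_pM2l // /s.
  apply: ltr_pwDl => //; rewrite (bigD1 i) //= (bigD1 j) //= -addrA lerDl.
  by rewrite addr_ge0 ?sumr_ge0 // => k _; rewrite sumr_ge0.
have [h half] : exists h, e^-1 = h + h.
  by exists (e^-1 / 2); field; rewrite gt_eqF.
(* Here [M + M^T = - (e^-1 + A + A^T)], so the identity is a Lyapunov certificate that M is
   stable. *)
pose M := - A^T - h *: 1%:M.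
have MT : M^T = - A - h *: 1%:M.
  by rewrite /M linearB linearN linearZ /= trmxK trmx1.
have sM : stable M.
  apply: (ctrb_stable (posdef1 F n) (posdef_psd pN)); last exact: posdef_ctrb.
  by rewrite mulmx1 mul1mx MT /M half; mxlin.
have eZ := lyapsolP (C^T *m C) (stable_lyapmx sM).
set Z := lyapsol _ _ in eZ.
have pC : possemidef (C^T *m C).
  by have := possemidef_cong C^T (posdef_psd (posdef1 F p)); rewrite mulmx1 trmxK.
have pZ : posdef Z.
  apply: (stable_lyap_pd sM pC eZ) => k U sU UC.
  apply: (cAC _ U).
    have -> : A^T = - M - h *: 1%:M by rewrite /M opprB addrAC subrr add0r opprK.
    rewrite mulmxBr mulmxN -scalemxAr mulmx1 -scaleN1r -scaleNr.
    by rewrite addmx_sub ?scalemx_sub.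
  by apply: (posdef_cong_kill (posdef1 F p)); rewrite mulmx1 trmxK.
have uZ := posdef_free pZ.
(* The equation of Z says [A^T Z + Z A = C^T C - e^-1 Z]. This gain subtracts [2 C^T C], leaving the
   negative of a positive definite source. *)
exists (invmx Z *m C^T); rewrite -[A - _]trmxK; apply: stable_tr.
apply: (ctrb_stable (N := e^-1 *: Z + C^T *m C) pZ).
- by apply/posdef_psd/posdefD => //; apply: posdefZ => //; rewrite invr_gt0.
- rewrite trmxK linearB /= !trmx_mul trmxK trmx_inv (posdef_sym pZ).
  rewrite mulmxBl mulmxBr !mulmxA mulmxKV // mulmxV // mul1mx.
  rewrite -[RHS]oppr0 -eZ MT /M half.
  by mxring.
- by apply/posdef_ctrb/posdefD => //; apply: posdefZ => //; rewrite invr_gt0.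
Qed.

Variables (W : 'M[F]_n) (V : 'M[F]_p).
Hypotheses (pW : possemidef W) (pV : posdef V).
Hypotheses (cAW : ctrb A W) (cAC : ctrb A^T C^T).

Definition gain (P : 'M[F]_n) : 'M[F]_(n, p) := P *m C^T *m invmx V.
(** The intensity of the noise w - L v that drives the error of an observer with gain L. *)
Definition src (L : 'M[F]_(n, p)) : 'M[F]_n := W + L *m V *m L^T.

Lemma src_psd L : possemidef (src L).
Proof. by apply: possemidefD => //; exact/possemidef_cong/posdef_psd. Qed.

(** Whatever the source kills is killed by W and by L, so A and [A - L C] agree on it. The extra N
    accommodates the square in [kleinman]. *)
Lemma ctrb_src L (N : 'M[F]_n) : possemidef N -> ctrb (A - L *m C) (src L + N).
Proof.
move=> pN k U sU e; have [e1 _] := possemidefD_kill (src_psd L) pN e.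
have pL : possemidef (L *m V *m L^T) by exact/possemidef_cong/posdef_psd.
have [UW UL] := possemidefD_kill pW pL e1.
have {}UL := posdef_cong_kill pV UL.
apply: (cAW (U := U)) => //; have -> : U *m A = U *m (A - L *m C); last by [].
by rewrite mulmxBr mulmxA UL mul0mx subr0.
Qed.

Let uV : V \in unitmx := posdef_free pV.
Let sV : V^T = V := posdef_sym pV.

Lemma gainV P : gain P *m V = P *m C^T.
Proof. by rewrite /gain mulmxKV. Qed.

Lemma gain_tr P : P^T = P -> V *m (gain P)^T = C *m P.
Proof. by move=> sP; rewrite -[LHS]trmxK trmx_mul trmxK sV gainV trmx_mul trmxK sP. Qed.

(** With L the gain of P, the three terms [L C P], [P C^T L^T] and [L V L^T] coincide. *)
Lemma riccati_lyap P : P^T = P ->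
  filter_riccati A C W V P <->
  (A - gain P *m C) *m P + P *m (A - gain P *m C)^T + src (gain P) = 0.
Proof.
move=> sP; rewrite /filter_riccati.
suff -> : (A - gain P *m C) *m P + P *m (A - gain P *m C)^T + src (gain P) =
  A *m P + P *m A^T - P *m C^T *m invmx V *m C *m P + W by [].
have e : P *m (gain P *m C)^T = gain P *m C *m P.
  by rewrite trmx_mul mulmxA -gainV -!mulmxA gain_tr.
rewrite /src -mulmxA gain_tr // linearB /= mulmxBl mulmxBr e -/(gain P).
by mxring.
Qed.

Lemma riccati_pd P : possemidef P -> filter_riccati A C W V P -> posdef P.
Proof.
move=> pP /(riccati_lyap (possemidef_sym pP)) e.
apply: psd_ctrb_pd e _ => //; first exact: src_psd.
by rewrite -[src _]addr0; exact/ctrb_src/possemidef0.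
Qed.

Lemma riccati_stable P : posdef P -> filter_riccati A C W V P ->
  stable (A - gain P *m C).
Proof.
move=> pP /(riccati_lyap (posdef_sym pP)) e.
apply: (ctrb_stable pP (src_psd _) e).
by rewrite -[src _]addr0; exact/ctrb_src/possemidef0.
Qed.

(** The mixed term [P C^T V^-1 C P'] can be attached to either gain, so [P - P'] solves a
    homogeneous Sylvester equation with the two stable closed-loop matrices. *)
Lemma riccati_unique P P' : posdef P -> filter_riccati A C W V P ->
  posdef P' -> filter_riccati A C W V P' -> P = P'.
Proof.
move=> pP rP pP' rP'; apply/eqP; rewrite -subr_eq0; apply/eqP.
apply: (sylvester_inj (riccati_stable pP rP) (stable_tr (riccati_stable pP' rP'))).
rewrite -[RHS](subrr 0) -{1}rP -rP'.
have e : P *m (gain P' *m C)^T = gain P *m C *m P'.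
  rewrite trmx_mul mulmxA -gainV -!mulmxA; congr (_ *m _).
  by rewrite gain_tr // posdef_sym.
have e' : P' *m (gain P' *m C)^T = gain P' *m C *m P'.
  rewrite trmx_mul mulmxA -gainV -!mulmxA; congr (_ *m _).
  by rewrite gain_tr // posdef_sym.
rewrite [(A - _)^T]linearB /= mulmxBl !mulmxBr 2!mulmxBl e e' /gain.
by mxring.
Qed.

(* Completing the square shows that a Newton-Kleinman step preserves stability
   and decreases the solution. *)
Lemma kleinman L : stable (A - L *m C) ->
  let P := lyapsol (A - L *m C) (src L) in
  [/\ posdef P, stable (A - gain P *m C)
    & possemidef (P - lyapsol (A - gain P *m C) (src (gain P)))].
Proof.
move=> sL P; have eP : _ *m P + P *m _ + _ = 0 := lyapsolP (src L) (stable_lyapmx sL).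
have cL : ctrb (A - L *m C) (src L).
  by rewrite -[src _]addr0; exact/ctrb_src/possemidef0.
have pP : posdef P := stable_lyap_pd sL (src_psd L) eP cL.
clearbody P; set L' := gain P; pose N := (L - L') *m V *m (L - L')^T.
have pN : possemidef N by exact/possemidef_cong/posdef_psd.
(* Since [L' V = P C^T], replacing L by [L'] in the equation of P leaves exactly the square N. *)
have e : (A - L' *m C) *m P + P *m (A - L' *m C)^T + (src L' + N) = 0.
  have gP : V *m L'^T = C *m P := gain_tr (posdef_sym pP).
  have gV : L' *m V = P *m C^T := gainV P.
  rewrite /N; clearbody N; clearbody L'.
  have tB k l (Y Z : 'M[F]_(k, l)) : (Y - Z)^T = Y^T - Z^T by exact: linearB.
  have CP k (Y : 'M[F]_(k, p)) : Y *m C *m P = Y *m V *m L'^T by rewrite -!mulmxA gP.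
  rewrite -eP /src !tB !trmx_mul.
  rewrite !(mulmxDl, mulmxDr, mulNmx, mulmxN, mulmxA) !CP -gV.
  by mxlin.
have sL' : stable (A - L' *m C).
  apply: (ctrb_stable pP _ e); last exact: ctrb_src.
  by apply: possemidefD => //; exact: src_psd.
(* The new solution has source [src L'] alone, so the difference has source N. *)
split=> //; apply: (stable_lyap_psd sL' pN).
have := lyapsolP (src L') (stable_lyapmx sL'); set X := lyapsol _ _ => eX.
rewrite -[RHS](subrr 0) -{1}e -eX; clearbody X N L'; move: (src L') => s.
by mxring.
Qed.

(** The iterates decrease and stay positive, so their quadratic forms converge. The limit is a
    priori only semidefinite; [riccati_pd] makes it definite. *)
Lemma riccati_exists : exists2 P, posdef P & filter_riccati A C W V P.
Proof.
have [L0 sL0] := detectable cAC.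
pose step L := lyapsol (A - L *m C) (src L).
pose Ls k := iter k (fun L => gain (step L)) L0.
pose Pk k := step (Ls k).
have sLs k : stable (A - Ls k *m C).
  elim: k => [|k IH]; first exact: sL0.
  by have [_ H _] := kleinman IH; exact: H.
have pPk k : posdef (Pk k) by have [H _ _] := kleinman (sLs k); exact: H.
have dec k : possemidef (Pk k - Pk k.+1).
  by have [_ _ H] := kleinman (sLs k); exact: H.
have ePk k : (A - gain (Pk k) *m C) *m Pk k.+1
    + Pk k.+1 *m (A - gain (Pk k) *m C)^T + src (gain (Pk k)) = 0.
  exact: (lyapsolP (src (Ls k.+1)) (stable_lyapmx (sLs k.+1))).
clearbody Pk; clear step Ls sLs.
have qcvg x : cvgn (fun k => qf (Pk k) x x).
  apply: nonincreasing_is_cvgn.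
    apply/nonincreasing_seqP => k; have := possemidef_qf x (dec k).
    by rewrite qf_addmx -scaleN1r qf_scalemx mulN1r subr_ge0.
  by exists 0 => _ [k _ <-]; exact/possemidef_qf/posdef_psd.
pose e i : 'rV[F]_n := delta_mx 0 i.
(* Polarization transfers convergence from the quadratic forms to the entries. *)
have Pkij k i j : Pk k i j =
    2^-1 * (qf (Pk k) (e i + e j) (e i + e j)
      - qf (Pk k) (e i) (e i) - qf (Pk k) (e j) (e j)).
  have sP := posdef_sym (pPk k).
  rewrite -{1 2}(scale1r (e i)) qfDl !qfDr (qfC (e j) (e i) sP).
  by rewrite /e !qf_delta; field.
pose P : 'M[F]_n := \matrix_(i, j) limn (fun k => Pk k i j).
have PkP : mcvg \oo%classic Pk P.
  move=> i j; rewrite mxE; apply: cvgP.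
  under eq_fun do rewrite Pkij.
  apply: cvgM; first exact: cvg_cst.
  by apply: cvgB; [apply: cvgB|]; exact: qcvg.
have pP : possemidef P.
  by apply: (mcvg_psd _ PkP); apply: nearW => k; exact: posdef_psd.
have PkS : mcvg \oo%classic (fun k => Pk k.+1) P.
  by move=> i j; have := PkP i j; rewrite -(cvg_shiftS (fun k => Pk k i j)).
have gP : mcvg \oo%classic (fun k => gain (Pk k)) (gain P).
  by apply: mcvgM; [apply: mcvgM|]; [exact: PkP|exact: mcvg_cst|exact: mcvg_cst].
have cP : mcvg \oo%classic (fun k => A - gain (Pk k) *m C) (A - gain P *m C).
  by apply: mcvgD; [exact: mcvg_cst|apply: mcvgN; apply: mcvgM => //; exact: mcvg_cst].
have rP : filter_riccati A C W V P.
  apply/riccati_lyap; first exact: possemidef_sym.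
  (* The recursion expression is constantly 0 and tends to the Lyapunov form of the Riccati
     expression at P, since consecutive iterates share their limit. *)
  apply: (@mcvg_unique _ _ \oo%classic _ _ _ (fun k =>
    (A - gain (Pk k) *m C) *m Pk k.+1 + Pk k.+1 *m (A - gain (Pk k) *m C)^T
    + src (gain (Pk k)))); last by rewrite (funext ePk); exact: mcvg_cst.
  apply: mcvgD; first by apply: mcvgD; apply: mcvgM => //; exact: mcvg_tr.
  apply: mcvgD; first exact: mcvg_cst.
  by apply: mcvgM; [apply: mcvgM => //; exact: mcvg_cst|exact: mcvg_tr].
by exists P => //; exact: riccati_pd.
Qed.

Lemma riccati_exists_unique :
  exists P, unique (fun P' => posdef P' /\ filter_riccati A C W V P') P.
Proof.
have [P pP rP] := riccati_exists; exists P; split=> // P' [pP' rP'].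
exact: riccati_unique.
Qed.

End Riccati.

(** * The gradient of the LQG cost *)

Section Gradient.
Variable F : realType.

(** The operators of the two equations are adjoint for the trace pairing. *)
Lemma lyap_dual n (M X Y N G : 'M[F]_n) :
  M *m X + X *m M^T + N = 0 -> M^T *m Y + Y *m M + G = 0 ->
  \tr (G *m X) = \tr (Y *m N).
Proof.
move=> /eqP; rewrite addrC addr_eq0 => /eqP ->.
move=> /eqP; rewrite addrC addr_eq0 => /eqP ->.
rewrite mulNmx mulmxN !linearN /= mulmxDl mulmxDr !mxtraceD; congr (- _).
rewrite addrC; congr (_ + _); first by rewrite mulmxA.
by rewrite -mulmxA mxtrace_mulC -mulmxA.
Qed.

Lemma mxtrace_delta_eq0 m n (M : 'M[F]_(m, n)) :
  (forall i j, \tr (delta_mx i j *m M) = 0) -> M = 0.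
Proof.
move=> H; apply/matrixP => i j; rewrite mxE -[RHS](H j i).
rewrite /mxtrace (bigD1 j) //= big1 ?addr0 => [|k kj].
  by rewrite mxE (bigD1 i) //= !mxE !eqxx mul1r big1 ?addr0 // => l li;
    rewrite !mxE (negbTE li) andbF mul0r.
by rewrite mxE big1 // => l _; rewrite !mxE (negbTE kj) mul0r.
Qed.

Lemma delta_mx_dr m n p q (i : 'I_n) (j : 'I_q) :
  delta_mx (rshift m i) (rshift p j) = block_mx 0 0 0 (delta_mx i j) :> 'M[F]_(m + n, p + q).
Proof.
apply/matrixP => k l; case: (split_ordP k) => k' ->; case: (split_ordP l) => l' ->;
  by rewrite ?(block_mxEul, block_mxEur, block_mxEdl, block_mxEdr) !mxE
     ?eq_lrshift ?eq_rshift ?andbF.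
Qed.

Lemma delta_mx_dl m n p q (i : 'I_n) (j : 'I_p) :
  delta_mx (rshift m i) (lshift q j) = block_mx 0 0 (delta_mx i j) 0 :> 'M[F]_(m + n, p + q).
Proof.
apply/matrixP => k l; case: (split_ordP k) => k' ->; case: (split_ordP l) => l' ->;
  by rewrite ?(block_mxEul, block_mxEur, block_mxEdl, block_mxEdr) !mxE
     ?eq_lrshift ?eq_rlshift ?eq_rshift ?eq_lshift ?andbF.
Qed.

Lemma delta_mx_ur m n p q (i : 'I_m) (j : 'I_q) :
  delta_mx (lshift n i) (rshift p j) = block_mx 0 (delta_mx i j) 0 0 :> 'M[F]_(m + n, p + q).
Proof.
apply/matrixP => k l; case: (split_ordP k) => k' ->; case: (split_ordP l) => l' ->;
  by rewrite ?(block_mxEul, block_mxEur, block_mxEdl, block_mxEdr) !mxE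
     ?eq_lrshift ?eq_rlshift ?eq_rshift ?eq_lshift ?andbF.
Qed.

Variables (n m p : nat) (A : 'M[F]_n) (B : 'M[F]_(n, m)) (C : 'M[F]_(p, n)).
Variables (W : 'M[F]_n) (V : 'M[F]_p) (Q : 'M[F]_n) (R : 'M[F]_m).
Hypotheses (sW : W^T = W) (sV : V^T = V) (sR : R^T = R).

Implicit Types K E : 'M[F]_(m + n, p + n).

(** The suffix [_dir] marks a first-order term in direction E; the closed loop is affine in the
    controller, noise and weight are quadratic, so the expansions below are exact. *)
Definition cl_dir E : 'M[F]_(n + n) :=
  block_mx 0 (B *m ctrl_C E) (ctrl_B E *m C) (ctrl_A E).
Definition noise_mx K : 'M[F]_(n + n) :=
  block_mx W 0 0 (ctrl_B K *m V *m (ctrl_B K)^T).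
Definition weight_mx K : 'M[F]_(n + n) :=
  block_mx Q 0 0 ((ctrl_C K)^T *m R *m ctrl_C K).
Definition noise_dir K E : 'M[F]_(n + n) :=
  block_mx 0 0 0 (ctrl_B E *m V *m (ctrl_B K)^T + ctrl_B K *m V *m (ctrl_B E)^T).
Definition weight_dir K E : 'M[F]_(n + n) :=
  block_mx 0 0 0 ((ctrl_C E)^T *m R *m ctrl_C K + (ctrl_C K)^T *m R *m ctrl_C E).

Lemma ctrl_AD K E h : ctrl_A (h *: E + K) = h *: ctrl_A E + ctrl_A K.
Proof. by apply/matrixP => i j; rewrite !mxE. Qed.

Lemma ctrl_BD K E h : ctrl_B (h *: E + K) = h *: ctrl_B E + ctrl_B K.
Proof. by apply/matrixP => i j; rewrite !mxE. Qed.

Lemma ctrl_CD K E h : ctrl_C (h *: E + K) = h *: ctrl_C E + ctrl_C K.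
Proof. by apply/matrixP => i j; rewrite !mxE. Qed.

Lemma closed_loopD K E h :
  closed_loop A B C (h *: E + K) = closed_loop A B C K + h *: cl_dir E.
Proof.
rewrite /closed_loop /cl_dir ctrl_AD ctrl_BD ctrl_CD.
rewrite scale_block_mx add_block_mx scaler0 addr0 mulmxDl mulmxDr.
by rewrite -scalemxAl -scalemxAr ![h *: _ + _]addrC.
Qed.

Lemma noise_mxD K E h : noise_mx (h *: E + K) =
  noise_mx K + h *: noise_dir K E
    + h ^+ 2 *: block_mx 0 0 0 (ctrl_B E *m V *m (ctrl_B E)^T).
Proof.
rewrite /noise_mx /noise_dir !scale_block_mx !add_block_mx !scaler0 !addr0.
rewrite ctrl_BD.
move: (ctrl_B E) (ctrl_B K) => E' K'; congr block_mx.
by rewrite [(_ + _)^T]linearD linearZ /=; mxring.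
Qed.

Lemma weight_mxD K E h : weight_mx (h *: E + K) =
  weight_mx K + h *: weight_dir K E
    + h ^+ 2 *: block_mx 0 0 0 ((ctrl_C E)^T *m R *m ctrl_C E).
Proof.
rewrite /weight_mx /weight_dir !scale_block_mx !add_block_mx !scaler0 !addr0.
rewrite ctrl_CD.
move: (ctrl_C E) (ctrl_C K) => E' K'; congr block_mx.
by rewrite [(_ + _)^T]linearD linearZ /=; mxring.
Qed.

Lemma noise_mx_sym K : (noise_mx K)^T = noise_mx K.
Proof. by rewrite /noise_mx tr_block_mx !trmx_mul trmxK sW sV !trmx0 mulmxA. Qed.

Lemma lqg_covE K : lyapmx (closed_loop A B C K) \in unitmx ->
  lqg_cov A B C W V K = lyapsol (closed_loop A B C K) (noise_mx K).
Proof.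
move=> u; apply: xget_unique; first exact: lyapsolP.
by move=> X; exact: lyapsol_unique.
Qed.

(** * Directional derivatives of the cost *)

Section Derivative.
Local Open Scope classical_set_scope.

(** The dual solution Y eliminates the derivative of the covariance: for small nonzero h the
    difference quotient equals [g h], whose limit follows from continuity of [lyapsol]. *)
Lemma lqg_deriveE K E Y : stable (closed_loop A B C K) -> Y^T = Y ->
  (closed_loop A B C K)^T *m Y + Y *m closed_loop A B C K + weight_mx K = 0 ->
  'D_E (lqg_cost A B C W V Q R : _ -> F^o) K =
    \tr (weight_dir K E *m lqg_cov A B C W V K) + \tr (Y *m noise_dir K E)
    + 2 * \tr (cl_dir E *m lqg_cov A B C W V K *m Y).
Proof.
move=> sK sY eY; set M := closed_loop A B C K in sK eY *.
have u := stable_lyapmx sK; rewrite (lqg_covE u).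
set X0 := lyapsol _ _.
pose Xh h := lyapsol (closed_loop A B C (h *: E + K)) (noise_mx (h *: E + K)).
have h0 : h @[h --> (0 : F)^'] --> (0 : F) by apply: cvg_within_filter; exact: cvg_id.
have clc : mcvg (0 : F)^' (fun h => closed_loop A B C (h *: E + K)) M.
  under eq_fun do rewrite closed_loopD.
  have : mcvg (0 : F)^' (fun h => M + h *: cl_dir E) (M + 0 *: cl_dir E).
    by apply: mcvgD; [exact: mcvg_cst|apply: mcvgZ => //; exact: mcvg_cst].
  by rewrite scale0r addr0.
have Nc : mcvg (0 : F)^' (fun h => noise_mx (h *: E + K)) (noise_mx K).
  under eq_fun do rewrite noise_mxD.
  set n1 := noise_dir K E; set n2 := block_mx _ _ _ _.
  have : mcvg (0 : F)^' (fun h => noise_mx K + h *: n1 + h ^+ 2 *: n2)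
      (noise_mx K + 0 *: n1 + (0 * 0) *: n2).
    apply: mcvgD; first apply: mcvgD; [exact: mcvg_cst| |].
      by apply: mcvgZ => //; exact: mcvg_cst.
    apply: mcvgZ; last exact: mcvg_cst.
    by under eq_fun do rewrite expr2; exact: cvgM.
  by rewrite mul0r !scale0r !addr0.
have Xc : mcvg (0 : F)^' Xh X0 by exact: mcvg_lyapsol.
pose q2 : 'M[F]_(n + n) := block_mx 0 0 0 ((ctrl_C E)^T *m R *m ctrl_C E).
pose n2 : 'M[F]_(n + n) := block_mx 0 0 0 (ctrl_B E *m V *m (ctrl_B E)^T).
pose g h := \tr (weight_dir K E *m Xh h) + \tr (Y *m noise_dir K E)
    + 2 * \tr (cl_dir E *m Xh h *m Y) + h * (\tr (q2 *m Xh h) + \tr (Y *m n2)).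
apply: cvg_lim; first exact: Rhausdorff.
(* The part of order h of the closed-loop matrix is moved into the source, so that [lyap_dual]
   applies with the unperturbed M. *)
have XhY h : lyapmx (closed_loop A B C (h *: E + K)) \in unitmx ->
    \tr (weight_mx K *m Xh h) =
    \tr (Y *m noise_mx (h *: E + K)) + 2 * h * \tr (cl_dir E *m Xh h *m Y).
  move=> uh; have := lyapsolP (noise_mx (h *: E + K)) uh; rewrite -/(Xh h).
  have sX : (Xh h)^T = Xh h by apply: lyapsol_sym => //; exact: noise_mx_sym.
  move: (Xh h) sX => X sX; rewrite closed_loopD -/M => eX.
  have {}eX : M *m X + X *m M^T + (noise_mx (h *: E + K)
      + h *: (cl_dir E *m X + X *m (cl_dir E)^T)) = 0.
    by rewrite -eX [(M + _)^T]linearD linearZ /=; mxring.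
  rewrite (lyap_dual eX eY) mulmxDr mxtraceD; congr (_ + _).
  rewrite -scalemxAr mxtraceZ mulmxDr mxtraceD.
  have -> : \tr (Y *m (X *m (cl_dir E)^T)) = \tr (cl_dir E *m X *m Y).
    by rewrite -[LHS]mxtrace_tr !trmx_mul trmxK sX sY.
  by rewrite (mxtrace_mulC Y); ring.
suff gc : g h @[h --> (0 : F)^'] --> \tr (weight_dir K E *m X0)
    + \tr (Y *m noise_dir K E) + 2 * \tr (cl_dir E *m X0 *m Y).
  apply: cvg_trans gc; apply: near_eq_cvg.
  have nz : \forall h \near (0 : F)^', h != 0 by exact: nbhs_dnbhs_neq.
  (* Invertibility of the Lyapunov operator persists near 0 and identifies the covariance at the
     perturbed controller. *)
  have un : \forall h \near (0 : F)^', lyapmx (closed_loop A B C (h *: E + K)) \in unitmx.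
    by apply: mcvg_unit u (mcvg_lyapmx clc).
  near=> h.
  have hn : h != 0 by near: h.
  have uh : lyapmx (closed_loop A B C (h *: E + K)) \in unitmx by near: h.
  rewrite /= /shift /lqg_cost /= (lqg_covE u) (lqg_covE uh).
  rewrite -/(weight_mx (h *: E + K)) -/(weight_mx K) -/X0 -/(Xh h).
  have e0 : \tr (weight_mx K *m X0) = \tr (Y *m noise_mx K).
    exact: lyap_dual (lyapsolP _ u) eY.
  rewrite e0 weight_mxD !mulmxDl !mxtraceD (XhY h uh) noise_mxD !mulmxDr !mxtraceD.
  rewrite -!scalemxAl -!scalemxAr !mxtraceZ /g -/q2 -/n2.
  by rewrite -[_ *: _]/(_ * _); field.
suff : g h @[h --> (0 : F)^'] --> \tr (weight_dir K E *m X0)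
    + \tr (Y *m noise_dir K E) + 2 * \tr (cl_dir E *m X0 *m Y)
    + 0 * (\tr (q2 *m X0) + \tr (Y *m n2)) by rewrite mul0r addr0.
have tX (Z : 'M[F]_(n + n)) : \tr (Z *m Xh h) @[h --> (0 : F)^'] --> \tr (Z *m X0).
  by apply: mcvg_mxtrace; apply: mcvgM => //; exact: mcvg_cst.
apply: cvgD; last apply: cvgM => //; last first.
  by apply: cvgD; [exact: tX|exact: cvg_cst].
apply: cvgD; first by apply: cvgD; [exact: tX|exact: cvg_cst].
apply: cvgM; first exact: cvg_cst.
apply: mcvg_mxtrace; apply: mcvgM; last exact: mcvg_cst.
by apply: mcvgM => //; exact: mcvg_cst.
Unshelve. all: by end_near. Qed.

End Derivative.

(** * Stationarity equations, one for each block of the controller *)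

Section Stationary.
Variables (K : 'M[F]_(m + n, p + n)) (X11 X12 X22 Y11 Y12 Y22 : 'M[F]_n).
Let Y : 'M[F]_(n + n) := block_mx Y11 Y12 Y12^T Y22.
Hypotheses (sK : stable (closed_loop A B C K))
  (XE : lqg_cov A B C W V K = block_mx X11 X12 X12^T X22)
  (sY : Y^T = Y) (sX22 : X22^T = X22)
  (eY : (closed_loop A B C K)^T *m Y + Y *m closed_loop A B C K + weight_mx K = 0)
  (gK : lqg_grad A B C W V Q R K = 0).

Let D := \matrix_(i, j) 'D_(delta_mx i j) (lqg_cost A B C W V Q R : _ -> F^o) K.

(** Along a direction in the A_K block noise and weight are constant, and the derivative is twice
    the trace of the direction against this matrix. *)
Lemma stationary_A : X12^T *m Y12 + X22 *m Y22 = 0.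
Proof.
apply: mxtrace_delta_eq0 => i j.
have : D (rshift m i) (rshift p j) = 0.
  have := congr1 drsubmx gK; rewrite /lqg_grad block_mxKdr -/D => /matrixP/(_ i j).
  by rewrite !mxE.
rewrite mxE (lqg_deriveE (delta_mx _ _) sK sY eY) XE delta_mx_dr; set E := block_mx _ _ _ _.
have [EA EB EC] : [/\ ctrl_A E = delta_mx i j, ctrl_B E = 0 & ctrl_C E = 0].
  by rewrite /ctrl_A /ctrl_B /ctrl_C block_mxKdr block_mxKdl block_mxKur.
rewrite /weight_dir /noise_dir /cl_dir EA EB EC /Y.
rewrite !(mulmx0, mul0mx, trmx0, add0r, addr0, mulmx_block, mxtrace_block, mxtrace0).
by rewrite -!mulmxA -mulmxDr => /eqP; rewrite mulf_eq0 pnatr_eq0 /= => /eqP.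
Qed.

(** By symmetry the two halves of [noise_dir] have equal trace against Y22, so a common factor 2
    cancels. *)
Lemma stationary_B : C *m (X11 *m Y12 + X12 *m Y22) + V *m (ctrl_B K)^T *m Y22 = 0.
Proof.
have sY22 : Y22^T = Y22 by have := sY; rewrite /Y tr_block_mx => /eq_block_mx[].
apply: mxtrace_delta_eq0 => i j.
have : D (rshift m i) (lshift n j) = 0.
  have := congr1 dlsubmx gK; rewrite /lqg_grad block_mxKdl -/D => /matrixP/(_ i j).
  by rewrite !mxE.
rewrite mxE (lqg_deriveE (delta_mx _ _) sK sY eY) XE delta_mx_dl; set E := block_mx _ _ _ _.
have [EA EB EC] : [/\ ctrl_A E = 0, ctrl_B E = delta_mx i j & ctrl_C E = 0].
  by rewrite /ctrl_A /ctrl_B /ctrl_C block_mxKdr block_mxKdl block_mxKur.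
rewrite /weight_dir /noise_dir /cl_dir EA EB EC /Y.
move: (ctrl_B K) (delta_mx i j) => BK d.
rewrite !(mulmx0, mul0mx, trmx0, add0r, addr0, mulmx_block, mxtrace_block, mxtrace0).
have t1 : \tr (Y22 *m (d *m V *m BK^T)) = \tr (d *m (V *m BK^T *m Y22)).
  by rewrite mxtrace_mulC !mulmxA.
have t2 : \tr (Y22 *m (BK *m V *m d^T)) = \tr (d *m (V *m BK^T *m Y22)).
  by rewrite -[LHS]mxtrace_tr !trmx_mul trmxK sY22 sV !mulmxA.
rewrite mulmxDr mxtraceD t1 t2 => e.
apply: (mulfI (_ : 2 != 0 :> F)); first by rewrite pnatr_eq0.
rewrite mulr0 -[RHS]e !mulmxDr !mulmxA !mxtraceD; ring.
Qed.

(** As for B_K, with the two halves of [weight_dir] paired with X22. *)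
Lemma stationary_C :
  (X12^T *m Y11 + X22 *m Y12^T) *m B + X22 *m (ctrl_C K)^T *m R = 0.
Proof.
apply: mxtrace_delta_eq0 => i j.
have : D (lshift n i) (rshift p j) = 0.
  have := congr1 ursubmx gK; rewrite /lqg_grad block_mxKur -/D => /matrixP/(_ i j).
  by rewrite !mxE.
rewrite mxE (lqg_deriveE (delta_mx _ _) sK sY eY) XE delta_mx_ur; set E := block_mx _ _ _ _.
have [EA EB EC] : [/\ ctrl_A E = 0, ctrl_B E = 0 & ctrl_C E = delta_mx i j].
  by rewrite /ctrl_A /ctrl_B /ctrl_C block_mxKdr block_mxKdl block_mxKur.
rewrite /weight_dir /noise_dir /cl_dir EA EB EC /Y.
move: (ctrl_C K) (delta_mx i j) => CK d.
rewrite !(mulmx0, mul0mx, trmx0, add0r, addr0, mulmx_block, mxtrace_block, mxtrace0).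
have t1 : \tr (d^T *m R *m CK *m X22) = \tr (d *m (X22 *m CK^T *m R)).
  by rewrite -[LHS]mxtrace_tr !trmx_mul trmxK sX22 sR !mulmxA mxtrace_mulC !mulmxA.
have t2 : \tr (CK^T *m R *m d *m X22) = \tr (d *m (X22 *m CK^T *m R)).
  by rewrite -(mulmxA _ d) mxtrace_mulC !mulmxA.
have t3 : \tr (B *m d *m X12^T *m Y11 + B *m d *m X22 *m Y12^T) =
    \tr (d *m ((X12^T *m Y11 + X22 *m Y12^T) *m B)).
  by rewrite -!mulmxA -!mulmxDr mxtrace_mulC !mulmxA.
rewrite mulmxDl mxtraceD t1 t2 t3 => e.
apply: (mulfI (_ : 2 != 0 :> F)); first by rewrite pnatr_eq0.
by rewrite mulr0 -[RHS]e mulmxDr mxtraceD; ring.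
Qed.

End Stationary.
End Gradient.

(** * Stationary controllers and the lower bound *)

Section Structure.
Variable F : realType.

(** If [U = [U1, U2]] is killed by the noise, then [U2 B_K = 0] decouples U1, which vanishes by
    controllability of the plant; U2 is then invariant under A_K and vanishes as well. *)
Lemma block_ctrb n m p (A AK : 'M[F]_n) (B : 'M[F]_(n, m)) (CK : 'M[F]_(m, n))
    (BK : 'M[F]_(n, p)) (C : 'M[F]_(p, n)) (W : 'M[F]_n) (V : 'M[F]_p) :
  posdef V -> ctrb A W -> ctrb AK BK ->
  ctrb (block_mx A (B *m CK) (BK *m C) AK) (block_mx W 0 0 (BK *m V *m BK^T)).
Proof.
move=> pV cAW cK k U; rewrite -[U]hsubmxK; move: (lsubmx U) (rsubmx U) => U1 U2.
rewrite !mul_row_block !mulmx0 addr0 add0r => sU /eqP.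
rewrite row_mx_eq0 => /andP[/eqP U1W /eqP U2B].
have {}U2B := posdef_cong_kill pV U2B.
have /submxP[D] := sU; rewrite mul_mx_row mulmxA U2B mul0mx addr0.
move=> /eq_row_mx[e1 e2].
have U10 : U1 = 0 by apply: cAW => //; rewrite e1 submxMl.
have U20 : U2 = 0.
  by apply: cK => //; apply/submxP; exists D; rewrite -e2 U10 mul0mx add0r.
by rewrite U10 U20 row_mx0.
Qed.

(* [1, T^-1] maps the closed-loop state to the estimation error x + T^-1 xi,
   which is uncorrelated with xi; P is its covariance. *)
Lemma filter_structure n m p (A AK : 'M[F]_n) (B : 'M[F]_(n, m)) (CK : 'M[F]_(m, n))
    (BK : 'M[F]_(n, p)) (C : 'M[F]_(p, n)) (W : 'M[F]_n) (V : 'M[F]_p)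
    (X11 X12 X22 T : 'M[F]_n) :
  let M := block_mx A (B *m CK) (BK *m C) AK in
  let X := block_mx X11 X12 X12^T X22 in
  let P := X11 + invmx T *m X12^T in
  posdef V -> posdef X -> X22 \in unitmx -> T \in unitmx -> T *m X12 = - X22 ->
  M *m X + X *m M^T + block_mx W 0 0 (BK *m V *m BK^T) = 0 ->
  BK *m V = - (T *m P *m C^T) ->
  [/\ posdef P, filter_riccati A C W V P, BK = - (T *m gain C V P),
      AK = T *m A *m invmx T - T *m B *m CK + BK *m C *m invmx T
    & row_mx 1%:M (invmx T) *m X *m (row_mx 1%:M (invmx T))^T = P].
Proof.
move=> M X P pV pX uX uT TX eX eB; have uV := posdef_free pV.
pose Ti := invmx T; pose e : 'M[F]_(n, n + n) := row_mx 1%:M Ti.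
have X12E : X12 = - (Ti *m X22).
  by rewrite -[X12](mulKmx uT) TX mulmxN.
have eXE : e *m X = row_mx P 0.
  by rewrite /e mul_row_block !mul1mx [X12 + _](_ : _ = 0) // X12E addNr.
have PE : e *m X *m e^T = P.
  by rewrite eXE tr_row_mx trmx1 mul_row_col mulmx1 mul0mx addr0.
clearbody P.
have pP : posdef P.
  rewrite -PE; apply: posdef_cong => //; apply/row_freeP.
  by exists (col_mx 1%:M 0); rewrite mul_row_col mulmx1 mulmx0 addr0.
have BKE : BK = - (T *m gain C V P).
  by rewrite -[BK](mulmxK uV) eB /gain mulNmx !mulmxA.
have TiB : Ti *m BK = - gain C V P by rewrite BKE mulmxN mulKmx.
have AKE : AK = T *m A *m Ti - T *m B *m CK + BK *m C *m Ti.
  (* Multiplying by e on the left and J on the right extracts the cross-covariance of the error with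
     xi; cancelling X22 there determines A_K. *)
  pose J : 'M[F]_(n + n, n) := col_mx 0 1%:M.
  have := congr1 (fun Z => e *m Z *m J) eX.
  rewrite /= mulmx0 mul0mx !mulmxDr !mulmxDl.
  have -> : e *m (X *m M^T) *m J = P *m C^T *m BK^T.
    rewrite mulmxA eXE /M tr_block_mx mul_row_block /J mul_row_col.
    by rewrite !mul0mx !addr0 mulmx0 add0r mulmx1 trmx_mul mulmxA.
  have -> : e *m block_mx W 0 0 (BK *m V *m BK^T) *m J = - (P *m C^T *m BK^T).
    rewrite /e mul_row_block /J mul_row_col !mulmx0 !add0r mulmx1.
    by rewrite eB !mulNmx mulmxN -!mulmxA mulKmx.
  rewrite addrK => e0.
  have {}e0 : ((B *m CK + Ti *m AK) - (A + Ti *m BK *m C) *m Ti) *m X22 = 0.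
    rewrite -e0 !mulmxA /e /M /X /J !mul_row_block mul_row_col !mulmx0 !mul1mx add0r mulmx1.
    by rewrite X12E mulmxBl mulmxN !mulmxA addrC.
  have /eqP : B *m CK + Ti *m AK - (A + Ti *m BK *m C) *m Ti = 0.
    by rewrite -[LHS](mulmxK uX) e0 mul0mx.
  rewrite subr_eq0 => /eqP /(congr1 (mulmx T)).
  rewrite !mulmxDr mulKVmx // => e1.
  apply: (addrI (T *m (B *m CK))); rewrite e1 mulmxDl !mulmxDr !mulmxA mulmxV // mul1mx.
  by mxlin.
split=> //; apply/(riccati_lyap A C W pV (posdef_sym pP)).
rewrite /src; move: (gain C V P) TiB => L TiB.
(* The error evolves autonomously with matrix [A - L C], so e compresses the closed-loop equation to
   that of P. *)
have eM : e *m M = (A - L *m C) *m e.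
  rewrite /e /M mul_row_block !mul1mx mul_mx_row mulmx1 mulmxA TiB mulNmx.
  congr row_mx; rewrite AKE !mulmxDr mulmxN !mulmxA !mulVmx // !mul1mx TiB.
  by mxring.
have e0 := congr1 (fun Z => e *m Z *m e^T) eX.
rewrite /= mulmx0 mul0mx !mulmxDr !mulmxDl in e0.
rewrite -[RHS]e0; congr (_ + _ + _).
- by rewrite !mulmxA eM -!mulmxA [e *m (X *m _)]mulmxA PE.
- by rewrite -!mulmxA -trmx_mul eM trmx_mul !mulmxA PE.
rewrite /e mul_row_block tr_row_mx mul_row_col trmx1 !mulmx0 addr0 add0r !mul1mx mulmx1.
by rewrite !mulmxA TiB -[_ *m BK^T *m _]mulmxA -trmx_mul TiB linearN /= mulmxN !mulNmx opprK.
Qed.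

(** The row f measures the deviation of u from the state feedback [- R^-1 B^T S x]. By the Riccati
    equation diag(S, 0) solves the dual Lyapunov equation whose source is the weight minus
    [f^T R f]. *)
Lemma cost_split n m p (A AK : 'M[F]_n) (B : 'M[F]_(n, m)) (CK : 'M[F]_(m, n))
    (BK : 'M[F]_(n, p)) (C : 'M[F]_(p, n)) (W Q S : 'M[F]_n) (R : 'M[F]_m) (N : 'M[F]_n)
    (X : 'M[F]_(n + n)) :
  let M := block_mx A (B *m CK) (BK *m C) AK in
  let f := row_mx (invmx R *m B^T *m S) CK in
  posdef R -> S^T = S -> control_riccati A B Q R S ->
  M *m X + X *m M^T + block_mx W 0 0 N = 0 ->
  \tr (block_mx Q 0 0 (CK^T *m R *m CK) *m X) =
    \tr (S *m W) + \tr (f^T *m R *m f *m X).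
Proof.
move=> M f pR sS rS eX; have uR := posdef_free pR; have sR := posdef_sym pR.
pose k := invmx R *m B^T *m S.
have kR : k^T *m R = S *m B.
  by rewrite /k !trmx_mul trmxK trmx_inv sS sR mulmxA mulmxKV.
have Rk : R *m k = B^T *m S by rewrite /k !mulmxA mulmxV // mul1mx.
pose G := block_mx Q 0 0 (CK^T *m R *m CK) - f^T *m R *m f.
pose E : 'M[F]_(n + n) := block_mx S 0 0 0.
have eG : M^T *m E + E *m M + G = 0.
  rewrite /G /M /E /f -/k tr_block_mx tr_row_mx mul_col_mx mul_col_row kR.
  rewrite !mulmx_block !(mulmx0, mul0mx, addr0, add0r) opp_block_mx !add_block_mx.
  rewrite !trmx_mul -[CK^T *m R *m k]mulmxA Rk /k !mulmxA.
  rewrite -block_mx0; congr block_mx; last 1 first.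
  - by rewrite subrr !add0r.
  - by rewrite -[RHS]rS; mxlin.
  - by rewrite !add0r; mxlin.
  - by rewrite add0r addr0 subrr.
have := lyap_dual eX eG; rewrite /E mulmx_block !(mulmx0, mul0mx, addr0, add0r).
rewrite mxtrace_block mxtrace0 addr0 => <-.
by rewrite -mxtraceD -mulmxDl /G subrK.
Qed.

(** With L the gain of P, the Riccati equation turns the source for [X - diag(P, 0)] into [[L; B_K]
    V [L; B_K]^T]. *)
Lemma cov_lower n m p (A AK : 'M[F]_n) (B : 'M[F]_(n, m)) (CK : 'M[F]_(m, n))
    (BK : 'M[F]_(n, p)) (C : 'M[F]_(p, n)) (W P : 'M[F]_n) (V : 'M[F]_p)
    (X : 'M[F]_(n + n)) :
  let M := block_mx A (B *m CK) (BK *m C) AK in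
  stable M -> posdef V -> P^T = P -> filter_riccati A C W V P ->
  M *m X + X *m M^T + block_mx W 0 0 (BK *m V *m BK^T) = 0 ->
  possemidef (X - block_mx P 0 0 0).
Proof.
move=> M sM pV sP rP eX; have uV := posdef_free pV.
set L := gain C V P.
have LV : L *m V = P *m C^T := gainV C pV P.
have VL : V *m L^T = C *m P := gain_tr C pV sP.
clearbody L.
apply: (stable_lyap_psd sM (possemidef_cong (col_mx L BK) (posdef_psd pV))).
have /eqP := rP; rewrite /filter_riccati.
have -> : P *m C^T *m invmx V *m C *m P = L *m V *m L^T.
  by rewrite -LV mulmxK // -mulmxA -VL mulmxA.
rewrite addrC addr_eq0 => /eqP WE.
rewrite -[RHS]eX [_ *m (X - _)]mulmxBr [(X - _) *m _]mulmxBl.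
rewrite tr_col_mx (mul_col_mx L BK V) mul_col_row LV.
rewrite [M *m block_mx _ _ _ _]mulmx_block.
have -> : block_mx P 0 (0 : 'M[F]_n) 0 *m M^T =
    block_mx (P *m A^T) (P *m (BK *m C)^T) 0 0.
  by rewrite /M tr_block_mx mulmx_block !(mulmx0, mul0mx, addr0).
rewrite !(mulmx0, mul0mx, addr0, add0r).
have -> : block_mx W 0 0 (BK *m V *m BK^T) =
    block_mx (P *m C^T *m L^T) (P *m C^T *m BK^T) (BK *m V *m L^T) (BK *m V *m BK^T)
    - block_mx (A *m P) 0 (BK *m C *m P) 0
    - block_mx (P *m A^T) (P *m (BK *m C)^T) 0 0.
  rewrite !opp_block_mx !add_block_mx oppr0 !addr0 WE LV trmx_mul !mulmxA.
  congr block_mx; first by mxlin.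
    by rewrite subrr.
  by rewrite -mulmxA VL mulmxA subrr.
move: (block_mx (A *m P) _ _ _) (block_mx (P *m A^T) _ _ _).
move: (block_mx (P *m C^T *m L^T) _ _ _) => b1 b2 b3.
by mxlin.
Qed.

End Structure.

(** * Symmetric blocks and duality of the Riccati equations *)

Section Blocks.
Variable F : realType.

Lemma block_sym n (X : 'M[F]_(n + n)) : X^T = X ->
  X = block_mx (ulsubmx X) (ursubmx X) (ursubmx X)^T (drsubmx X).
Proof. by move=> sX; rewrite trmx_ursub sX submxK. Qed.

Lemma posdef_drsubmx n (X : 'M[F]_(n + n)) : posdef X -> posdef (drsubmx X).
Proof.
move=> pX; pose e : 'M[F]_(n, n + n) := row_mx 0 1%:M.
have -> : drsubmx X = e *m X *m e^T.
  rewrite -[X in e *m X]submxK /e tr_row_mx mul_row_block mul_row_col trmx0 trmx1.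
  by rewrite !mulmx0 !mul0mx !mul1mx !add0r mulmx1.
apply: posdef_cong => //; apply/row_freeP; exists (col_mx 0 1%:M).
by rewrite mul_row_col mulmx0 add0r mulmx1.
Qed.

Lemma possemidef_block n m (M : 'M[F]_n) (N : 'M[F]_m) :
  possemidef M -> possemidef N -> possemidef (block_mx M 0 0 N).
Proof.
move=> pM pN; have -> : block_mx M 0 0 N =
    col_mx 1%:M 0 *m M *m (col_mx 1%:M 0)^T + col_mx 0 1%:M *m N *m (col_mx 0 1%:M)^T.
  rewrite !tr_col_mx (mul_col_mx _ _ M) (mul_col_mx _ _ N) !mul_col_row add_block_mx !trmx0 !trmx1.
  by rewrite !(mul1mx, mulmx1, mul0mx, mulmx0, addr0, add0r).
by apply: possemidefD; exact: possemidef_cong.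
Qed.

Lemma unitmxN n (M : 'M[F]_n) : (- M \in unitmx) = (M \in unitmx).
Proof. by rewrite -scaleN1r unitmxZ // unitrN1. Qed.

Lemma filter_riccati_dual n m (A : 'M[F]_n) (B : 'M[F]_(n, m)) Q (R : 'M[F]_m) S :
  filter_riccati A^T B^T Q R S = control_riccati A B Q R S.
Proof. by rewrite /filter_riccati !trmxK. Qed.

End Blocks.

Theorem theorem4p3 (F : realType) (n m p : nat)
    (n_gt0 : (0 < n)%N) (m_gt0 : (0 < m)%N) (p_gt0 : (0 < p)%N)
    (A : 'M[F]_n) (B : 'M[F]_(n, m)) (C : 'M[F]_(p, n))
    (W : 'M[F]_n) (V : 'M[F]_p) (Q : 'M[F]_n) (R : 'M[F]_m)
    (W_psd : possemidef W) (V_pd : posdef V)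
    (Q_psd : possemidef Q) (R_pd : posdef R)
    (AB_ctrb : controllable A B) (AW_ctrb : controllable A (sqrtmx W))
    (CA_obsv : observable C A) (QA_obsv : observable (sqrtmx Q) A) :
  exists P S : 'M[F]_n,
    let K := invmx R *m B^T *m S in
    let L := P *m C^T *m invmx V in
    [/\ unique (fun P' => posdef P' /\ filter_riccati A C W V P') P,
        unique (fun S' => posdef S' /\ control_riccati A B Q R S') S
      & forall Kc : 'M[F]_(m + n, p + n),
          lqg_stationary A B C W V Q R Kc -> minimal_ctrl Kc ->
          lqg_optimal A B C W V Q R Kc /\
          exists T : 'M[F]_n,
            [/\ T \in unitmx,
                ctrl_A Kc = T *m (A - B *m K - L *m C) *m invmx T,
                ctrl_B Kc = - (T *m L)
              & ctrl_C Kc = K *m invmx T]].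
Proof.
have cW : ctrb A W := sqrtmx_ctrb n_gt0 (controllable_ctrb AW_ctrb).
have cC : ctrb A^T C^T := observable_ctrb CA_obsv.
have cB : ctrb A^T^T B^T^T by rewrite !trmxK; exact: controllable_ctrb.
have cQ : ctrb A^T Q.
  by apply: sqrtmx_ctrb => //; rewrite -sqrtmx_sym; exact: observable_ctrb.
have [P [[pP rP] uP]] := riccati_exists_unique W_psd V_pd cW cC.
(* S is the filter solution for the dual plant [(A^T, B^T)] with weights Q and R. *)
have [S [[pS rS] uS]] := riccati_exists_unique Q_psd R_pd cQ cB.
have sP := posdef_sym pP; have sS := posdef_sym pS.
have sV := posdef_sym V_pd; have sR := posdef_sym R_pd.
have sW := possemidef_sym W_psd.
exists P, S => K L; split=> //.
  split; first by split=> //; rewrite -filter_riccati_dual.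
  by move=> S' [pS' rS']; apply: uS; split=> //; rewrite filter_riccati_dual.
rewrite filter_riccati_dual in rS.
move=> Kc [stKc gK] [cK oK]; have sK := stKc.2.
have covE K' : stable (closed_loop A B C K') ->
    closed_loop A B C K' *m lqg_cov A B C W V K'
    + lqg_cov A B C W V K' *m (closed_loop A B C K')^T + noise_mx W V K' = 0.
  by move=> /stable_lyapmx u; rewrite lqg_covE //; exact: lyapsolP.
have costE K' : stable (closed_loop A B C K') ->
    lqg_cost A B C W V Q R K' = \tr (S *m W)
      + \tr ((row_mx K (ctrl_C K'))^T *m R *m row_mx K (ctrl_C K') *m lqg_cov A B C W V K').
  by move=> /covE e; exact: cost_split R_pd sS rS e.
have trE (f : 'M[F]_(m, n + n)) Z : \tr (f^T *m R *m f *m Z) = \tr (R *m (f *m Z *m f^T)).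
  by rewrite -!mulmxA mxtrace_mulC !mulmxA.
(* The trace of [f^T R f] against the semidefinite [X - diag(P, 0)] is nonnegative. *)
have lower K' : stable (closed_loop A B C K') ->
    \tr (S *m W) + \tr (R *m (K *m P *m K^T)) <= lqg_cost A B C W V Q R K'.
  move=> sK'; rewrite costE // lerD2l; set f := row_mx _ _.
  have := mxtrace_mul_psd (possemidef_cong f^T (posdef_psd R_pd))
    (cov_lower sK' V_pd sP rP (covE K' sK')).
  rewrite trmxK mulmxBr linearB /= subr_ge0; congr (_ <= _).
  rewrite trE /f tr_row_mx mul_row_block mul_row_col !mulmx0 !addr0.
  by rewrite mul0mx addr0.
have pNo (K' : 'M[F]_(m + n, p + n)) : possemidef (noise_mx W V K').
  by apply: possemidef_block => //; exact/possemidef_cong/posdef_psd.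
have weE (K' : 'M[F]_(m + n, p + n)) : weight_mx Q R K' =
    block_mx Q 0 0 ((ctrl_C K')^T *m R *m (ctrl_C K')^T^T) by rewrite trmxK.
have pWe (K' : 'M[F]_(m + n, p + n)) : possemidef (weight_mx Q R K').
  by rewrite weE; apply: possemidef_block => //; exact/possemidef_cong/posdef_psd.
set X := lqg_cov A B C W V Kc; have eX := covE Kc sK; rewrite -/X in eX.
have pX : posdef X.
  apply: (stable_lyap_pd sK (pNo Kc) eX); apply: block_ctrb => //.
  exact: controllable_ctrb cK.
have dualE : (closed_loop A B C Kc)^T =
    block_mx A^T (C^T *m (ctrl_B Kc)^T) ((ctrl_C Kc)^T *m B^T) (ctrl_A Kc)^T.
  by rewrite /closed_loop tr_block_mx !trmx_mul.
have sKt := stable_tr sK.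
pose Y := lyapsol (closed_loop A B C Kc)^T (weight_mx Q R Kc).
have eY : (closed_loop A B C Kc)^T *m Y + Y *m closed_loop A B C Kc + weight_mx Q R Kc = 0.
  by have := lyapsolP (weight_mx Q R Kc) (stable_lyapmx sKt); rewrite trmxK.
have pY : posdef Y.
  apply: (stable_lyap_pd sKt (pWe Kc)); first by rewrite trmxK; exact: eY.
  rewrite dualE weE; apply: block_ctrb => //.
  exact: observable_ctrb oK.
clearbody Y.
have sX := posdef_sym pX; have sY := posdef_sym pY.
have pX22 := posdef_drsubmx pX; have pY22 := posdef_drsubmx pY.
have XE := block_sym sX; have YE := block_sym sY.
have XE' : lqg_cov A B C W V Kc = _ := XE.
move: (ulsubmx X) (ursubmx X) (drsubmx X) pX22 XE XE' => X11 X12 X22 pX22 XE XE'.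
move: (ulsubmx Y) (ursubmx Y) (drsubmx Y) pY22 YE => Y11 Y12 Y22 pY22 YE.
rewrite YE in sY eY pY; rewrite XE in eX pX.
have sX22 := posdef_sym pX22.
have gA := stationary_A sW sV sK XE' sY eY gK.
have gB := stationary_B sW sV sK XE' sY eY gK.
have gC := stationary_C sW sV sR sK XE' sY sX22 eY gK.
have uX22 := posdef_free pX22; have uY22 := posdef_free pY22.
(* The A_K-equation makes [X12^T Y12 = - X22 Y22] invertible, hence both factors. *)
have uX12t : X12^T \in unitmx.
  have /eqP := gA; rewrite addr_eq0 => /eqP e.
  have : X12^T *m Y12 \in unitmx by rewrite e unitmxN unitmx_mul uX22.
  by rewrite unitmx_mul => /andP[].
have uX12 : X12 \in unitmx by rewrite -unitmx_tr.
pose T := - (X22 *m invmx X12).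
have uT : T \in unitmx by rewrite /T unitmxN unitmx_mul uX22 unitmx_inv.
have TX12 : T *m X12 = - X22 by rewrite /T mulNmx mulmxKV.
clearbody T.
have X12T : X12^T *m T^T = - X22 by rewrite -trmx_mul TX12 linearN /= sX22.
have Y12E : Y12 = T^T *m Y22.
  apply: (can_inj (mulKmx uX12t)); rewrite mulmxA X12T mulNmx.
  by apply/eqP; rewrite -addr_eq0 gA.
have sX11 : X11^T = X11.
  by have := posdef_sym pX; rewrite tr_block_mx => /eq_block_mx[].
(* Substituting [Y12 = T^T Y22] in the B_K-equation and cancelling Y22 gives the hypothesis of
   [filter_structure]. *)
have BV : ctrl_B Kc *m V = - (T *m (X11 + invmx T *m X12^T) *m C^T).
  have e : (C *m (X11 *m T^T + X12) + V *m (ctrl_B Kc)^T) *m Y22 = 0.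
    by rewrite -gB Y12E mulmxDl -!mulmxA mulmxDl !mulmxA.
  have {}e : C *m (X11 *m T^T + X12) + V *m (ctrl_B Kc)^T = 0.
    by rewrite -[LHS](mulmxK uY22) e mul0mx.
  have := congr1 trmx e; rewrite trmx0 linearD /= !trmx_mul linearD /= trmx_mul.
  rewrite !trmxK sV sX11 mulmxDr mulKVmx // addrC => /eqP.
  by rewrite addr_eq0 => /eqP.
have [pP0 rP0 BE AE PE] := filter_structure V_pd pX uX22 uT TX12 eX BV.
have P0 : X11 + invmx T *m X12^T = P by apply/esym/uP.
rewrite P0 in BE AE PE.
(* The coordinate change of the dual problem: [Y12 = T^T Y22] becomes [T' Y12 = - Y22]. *)
pose T' := - (invmx T)^T.
have uT' : T' \in unitmx by rewrite /T' unitmxN unitmx_tr unitmx_inv.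
have TT' : (invmx T)^T *m T^T = 1%:M by rewrite -trmx_mul mulmxV // trmx1.
have T'Y : T' *m Y12 = - Y22 by rewrite /T' Y12E mulNmx mulmxA TT' mul1mx.
have iT' : invmx T' = - T^T.
  have e : T' *m - T^T = 1%:M by rewrite /T' mulNmx mulmxN opprK.
  by rewrite -[LHS]mulmx1 -e mulKmx.
have CR : (ctrl_C Kc)^T *m R = - (T' *m (Y11 + invmx T' *m Y12^T) *m B^T^T).
  rewrite iT' trmxK /T' !mulNmx opprK.
  (* Writing X22 as [- X12^T T^T] exposes the invertible factor X12^T in the C_K-equation. *)
  have e : X12^T *m ((Y11 - T^T *m Y12^T) *m B - T^T *m (ctrl_C Kc)^T *m R) = 0.
    rewrite -gC -[X22]opprK -X12T; move: (ctrl_C Kc) => CK; mxring.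
  have {}e : (Y11 - T^T *m Y12^T) *m B = T^T *m (ctrl_C Kc)^T *m R.
    by apply/eqP; rewrite -subr_eq0 -[X in X == _](mulKmx uX12t) e mulmx0.
  by rewrite -mulmxA e !mulmxA TT' mul1mx.
have eYd := eY; rewrite dualE weE in eYd.
have eYd' : closed_loop A B C Kc =
    (block_mx A^T (C^T *m (ctrl_B Kc)^T) ((ctrl_C Kc)^T *m B^T) (ctrl_A Kc)^T)^T.
  by rewrite -dualE trmxK.
rewrite eYd' in eYd.
have [pS0 rS0 CE _ _] := filter_structure R_pd pY uY22 uT' T'Y eYd CR.
have S0 : Y11 + invmx T' *m Y12^T = S by apply/esym/uS.
rewrite S0 in CE.
have {}CE : ctrl_C Kc = K *m invmx T.
  rewrite -[LHS]trmxK CE /T' mulNmx opprK /gain !trmx_mul !trmxK.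
  by rewrite trmx_inv sR sS /K !mulmxA.
split; last first.
  have e k l Ti : T *m A *m Ti - T *m B *m (k *m Ti) + - (T *m l) *m C *m Ti =
      T *m (A - B *m k - l *m C) *m Ti by mxring.
  by exists T; split=> //; rewrite AE BE CE e.
split=> // K' [_ sK']; apply: le_trans (lower K' sK').
rewrite costE // lerD2l -/X trE.
(* The deviation of u factors through the estimation error, whose covariance is P, so the lower
   bound is attained. *)
have -> : row_mx K (ctrl_C Kc) = K *m row_mx 1%:M (invmx T).
  by rewrite mul_mx_row mulmx1 CE.
have e (k : 'M[F]_(m, n)) (f : 'M[F]_(n, n + n)) :
    k *m f *m X *m (k *m f)^T = k *m (f *m X *m f^T) *m k^T.
  by rewrite trmx_mul !mulmxA.
by rewrite e XE PE.
Qed.
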